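(* Let $k$ be a field. The linear map $$\psi:(\mathbf{PBT},\prec,\succ,\Delta_\prec,\Delta_\succ)\longrightarrow(\mathbf{ST},\preceq,\succ,\Delta_\prec,\Delta_\succ),\qquad t\longmapsto\sum_{t'\le t}t'$$ ($t$ a planar binary tree, $t'$ running over the Schröder trees with $t'\le t$; $\preceq\,:=\,\prec+\bullet$) is an injective morphism of bidendriform bialgebras; that is, $\psi$ is injective, $\psi(s\prec t)=\psi(s)\preceq\psi(t)$, $\psi(s\succ t)=\psi(s)\succ\psi(t)$, $\Delta_\prec\circ\psi=(\psi\otimes\psi)\circ\Delta_\prec$ and $\Delta_\succ\circ\psi=(\psi\otimes\psi)\circ\Delta_\succ$.
   Context: Trees: a Schröder tree of degree $n$ is a planar rooted tree with $n+1$ leaves in which every internal vertex has at least two children; $|$ is the tree of degree $0$. $t_1\vee\cdots\vee t_m$ ($m\ge2$) is the tree obtained by grafting $t_1,\dots,t_m$ from left to right on a common root. $\mathbf{ST}$ has basis the Schröder trees of degree $\ge1$, with products, for $t=t_1\vee\cdots\vee t_m$, $t'=t'_1\vee\cdots\vee t'_l$: $t\succ t'=(t\star t'_1)\vee t'_2\vee\cdots\vee t'_l$, $t\prec t'=t_1\vee\cdots\vee t_{m-1}\vee(t_m\star t')$, $t\bullet t'=t_1\vee\cdots\vee t_{m-1}\vee(t_m\star t'_1)\vee t'_2\vee\cdots\vee t'_l$ (multilinearly), $\star=\prec+\succ+\bullet$, $|$ being the unit of $\star$. $\mathbf{PBT}$ has basis the planar binary trees of degree $\ge1$ (all internal vertices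 have exactly two children), with $t\succ t'=(t\star t'_1)\vee t'_2$, $t\prec t'=t_1\vee(t_2\star t')$ for $t=t_1\vee t_2$, $t'=t'_1\vee t'_2$, $\star=\prec+\succ$, $|$ the unit of $\star$. Order: for a Schröder tree $t$, $R(t)$ is the set of edges $e$ both of whose extremities are internal vertices and such that $e$ is the rightmost among the edges going up from the same lower vertex. For $I\subseteq R(t)$, $t/I$ is obtained by contracting all edges of $I$. $t'\le t$ means $t'=t/I$ for some $I\subseteq R(t)$. Coproducts: a packed word of length $n$ is a word $\sigma$ of positive integers with set of letters $\{1,\dots,\max\sigma\}$; $Pack(u)$ is the packed word with the same relative order (and equalities) of letters as $u$; $\sigma_{|I}$ is the subword of letters belonging to $I$. On the span $\mathbf{QSh}_+$ of nonempty packed words, $\Delta_\prec(\sigma)=\sum_{i=\sigma(1)}^{\max\sigma-1}\sigma_{|\{1,\dots,i\}}\otimes Pack(\sigma_{|\{i+1,\dots,\max\sigma\}})$ and $\Delta_\succ(\sigma)=\sum_{i=1}^{\sigma(1)-1}\sigma_{|\{1,\dots,i\}}\otimes Pack(\sigma_{|\{i+1,\dots,\max\sigma\}})$; these restrict to the span $\mathbf{Sh}_+$ of nonempty permutations. Define $\varrho$ from packed words to Schröder trees by $\varrho(\text{empty word})=|$ and, if the letter $1$ occurs in $\sigma$ at positions $i_1<\cdots<i_q$ and $\sigma=u_1\,1\,u_2\,1\cdots1\,u_{q+1}$, $\varrho(\sigma)=\varrho(Pack(u_1))\vee\cdots\vee\varrho(Pack(u_{q+1}))$. The maps $\Omega:\mathbf{ST}\to\mathbf{QSh}_+$,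 $\Omega(t)=\sum_{\varrho(\sigma)=t}\sigma$ (sum over packed words), and $\Omega':\mathbf{PBT}\to\mathbf{Sh}_+$, $\Omega'(t)=\sum_{\varrho(\sigma)=t}\sigma$ (sum over permutations) are injective, and their images are stable under $\Delta_\prec,\Delta_\succ$; the coproducts $\Delta_\prec,\Delta_\succ$ of $\mathbf{ST}$ and $\mathbf{PBT}$ are those for which $\Omega$ and $\Omega'$ commute with $\Delta_\prec$ and $\Delta_\succ$. *)

(* Defs.v *)
From HB Require Import structures.
From mathcomp Require Import all_boot all_order all_algebra finmap.
From mathcomp Require Import monalg.

Set Implicit Arguments.
Unset Strict Implicit.
Unset Printing Implicit Defensive.

Import GRing.Theory.
Local Open Scope fset_scope.
Local Open Scope ring_scope.

(* {malg k[B]} is used throughout as the free k-module on the basis B. *)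
Definition lin_ext (k : fieldType) (B : choiceType) (V : lmodType k)
    (f : B -> V) (x : {malg k[B]}) : V :=
  \sum_(b <- msupp x) x@_b *: f b.

Lemma lin_extEw (k : fieldType) (B : choiceType) (V : lmodType k)
    (f : B -> V) (d : {fset B}) (x : {malg k[B]}) :
  msupp x `<=` d -> lin_ext f x = \sum_(b <- d) x@_b *: f b.
Proof.
move=> sxd; rewrite /lin_ext (big_fset_incl _ sxd) // => b _ bx.
by rewrite mcoeff_outdom ?scale0r.
Qed.

Fact lin_ext_is_linear (k : fieldType) (B : choiceType) (V : lmodType k)
    (f : B -> V) : linear (lin_ext f).
Proof.
move=> c x y; pose d := msupp x `|` msupp y `|` msupp (c *: x + y).
have [dx dy dxy] : [/\ msupp x `<=` d, msupp y `<=` d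
                   & msupp (c *: x + y) `<=` d].
  split; first by rewrite /d -fsetUA fsubsetUl.
    by rewrite /d (fsetUC (msupp x)) -fsetUA fsubsetUl.
  exact: fsubsetUr.
rewrite (lin_extEw _ dx) (lin_extEw _ dy) (lin_extEw _ dxy).
rewrite scaler_sumr -big_split /=; apply: eq_bigr => b _.
by rewrite mcoeffD mcoeffZ scalerDl scalerA.
Qed.

HB.instance Definition _ (k : fieldType) (B : choiceType) (V : lmodType k)
    (f : B -> V) :=
  GRing.isLinear.Build k {malg k[B]} V *:%R (lin_ext f) (lin_ext_is_linear f).

Lemma lin_extU (k : fieldType) (B : choiceType) (V : lmodType k)
    (f : B -> V) (b : B) : lin_ext f << b >> = f b.
Proof.
rewrite (@lin_extEw k B V f [fset b]) ?msuppU_le //.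
by rewrite big_seq_fset1 mcoeffUU scale1r.
Qed.

Definition bilin_ext (k : fieldType) (B C : choiceType) (V : lmodType k)
    (f : B -> C -> V) (x : {malg k[B]}) (y : {malg k[C]}) : V :=
  lin_ext (fun b => lin_ext (f b) y) x.

(* The tensor product of the free modules on B and on C is the free module on
   B * C, the pair (b, c) standing for the tensor of b and c. *)
Notation tensor k B C := {malg k[(B * C)%type]}.

Definition tens (k : fieldType) (B C : choiceType) :
    {malg k[B]} -> {malg k[C]} -> tensor k B C :=
  bilin_ext (fun b c => << (b, c) >>).

Definition tensmap (k : fieldType) (B C B' C' : choiceType)
    (f : {malg k[B]} -> {malg k[B']}) (g : {malg k[C]} -> {malg k[C']}) :
    {linear tensor k B C -> tensor k B' C'} :=
  lin_ext (fun p : B * C => tens (f << p.1 >>) (g << p.2 >>)).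

Definition commutes_with_coproducts (k : fieldType) (B C : choiceType)
    (f : {malg k[B]} -> {malg k[C]})
    (dB : {malg k[B]} -> tensor k B B)
    (dC : {malg k[C]} -> tensor k C C) : Prop :=
  forall x : {malg k[B]}, dC (f x) = tensmap f f (dB x).

(* stree1 is the type of Schroeder trees of degree at least 1, stree that of
   all Schroeder trees, None being the tree of degree 0.  The children of
   [SNode a s b], from left to right, are a, the elements of s, and b: there
   are at least two of them. *)
Inductive stree1 : Type :=
  SNode of option stree1 & seq (option stree1) & option stree1.

Notation stree := (option stree1).

Lemma stree1_nested_ind (P : stree1 -> Prop)
    (P' := fun x : stree => if x is Some t then P t else True) :
  (forall a s b, P' a -> foldr (fun x => and (P' x)) True s -> P' b ->
     P (SNode a s b)) ->
  forall t, P t.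
Proof.
move=> IH; fix rec 1 => t.
refine (match t with SNode a s b =>
  let recO x : P' x := if x is Some u then rec u else I in
  IH a s b (recO a) _ (recO b) end).
exact: (fix recs s : foldr (fun x => and (P' x)) True s :=
  if s is x :: s' then conj (recO x) (recs s') else I).
Qed.

Fixpoint stree1_code (t : stree1) : GenTree.tree unit :=
  let: SNode a s b := t in
  let c := oapp stree1_code (GenTree.Leaf tt) in
  GenTree.Node 0 (c a :: c b :: map c s).

Fixpoint stree_decode (g : GenTree.tree unit) : stree :=
  if g is GenTree.Node _ (a :: b :: s) then
    Some (SNode (stree_decode a) (map stree_decode s) (stree_decode b))
  else None.

Fact stree1_codeK : pcancel stree1_code stree_decode.
Proof.
elim/stree1_nested_ind => a s b Ha Hs Hb /=; congr (Some (SNode _ _ _)).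
- by case: a Ha.
- by elim: s Hs => //= x s IH [Hx /IH ->]; congr (_ :: _); case: x Hx.
- by case: b Hb.
Qed.

HB.instance Definition _ := Countable.copy stree1 (pcan_type stree1_codeK).

Fixpoint leaves1 (t : stree1) : nat :=
  let: SNode a s b := t in
  let l := oapp leaves1 1%N in (l a + sumn (map l s) + l b)%N.

Definition leaves (t : stree) : nat := oapp leaves1 1%N t.

Definition degree (t : stree) : nat := (leaves t).-1.

(* Junk value None for fewer than two trees. *)
Definition graft (ts : seq stree) : stree :=
  if ts is a :: x :: s then Some (SNode a (belast x s) (last x s)) else None.

Inductive ptree1 : Type := PNode of option ptree1 & option ptree1.

Notation ptree := (option ptree1).

Lemma ptree1_nested_ind (P : ptree1 -> Prop)
    (P' := fun x : ptree => if x is Some t then P t else True) :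
  (forall a b, P' a -> P' b -> P (PNode a b)) -> forall t, P t.
Proof.
move=> IH; fix rec 1 => t.
exact: (match t with PNode a b =>
  let recO x : P' x := if x is Some u then rec u else I in
  IH a b (recO a) (recO b) end).
Qed.

Fixpoint ptree1_code (t : ptree1) : GenTree.tree unit :=
  let: PNode a b := t in
  let c := oapp ptree1_code (GenTree.Leaf tt) in
  GenTree.Node 0 [:: c a; c b].

Fixpoint ptree_decode (g : GenTree.tree unit) : ptree :=
  if g is GenTree.Node _ [:: a; b] then
    Some (PNode (ptree_decode a) (ptree_decode b))
  else None.

Fact ptree1_codeK : pcancel ptree1_code ptree_decode.
Proof.
elim/ptree1_nested_ind => a b Ha Hb /=.
by congr (Some (PNode _ _)); [case: a Ha | case: b Hb].
Qed.

HB.instance Definition _ := Countable.copy ptree1 (pcan_type ptree1_codeK).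

(* A planar binary tree seen as a Schroeder tree. *)
Fixpoint schroeder1 (t : ptree1) : stree1 :=
  let: PNode a b := t in SNode (omap schroeder1 a) [::] (omap schroeder1 b).

Definition ST (k : fieldType) : lmodType k := {malg k[stree1]}.
Definition PBT (k : fieldType) : lmodType k := {malg k[ptree1]}.

(* The three summands are spelled out because they are mutually recursive;
   see st_star1E. *)
Fixpoint st_star1 (k : fieldType) (t : stree1) {struct t} :
    stree1 -> {malg k[stree1]} :=
  fix st_star1_t (t' : stree1) {struct t'} : {malg k[stree1]} :=
  let: SNode a s b := t in
  let: SNode a' s' b' := t' in
  let inj := lin_ext (fun u : stree1 => << Some u >> : {malg k[stree]}) in
  lin_ext (fun x : stree => << SNode a s x >>)
    (if b is Some u then inj (st_star1 k u t') else << Some t' >>)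
  + lin_ext (fun x : stree => << SNode x s' b' >>)
    (if a' is Some u' then inj (st_star1_t u') else << Some t >>)
  + lin_ext (fun x : stree => << SNode a (s ++ x :: s') b' >>)
    (match b, a' with
     | Some u, Some u' => inj (st_star1 k u u')
     | Some u, None => << Some u >>
     | None, y => << y >>
     end).

Definition st_star (k : fieldType) (t t' : stree) : {malg k[stree]} :=
  match t, t' with
  | Some u, Some u' => lin_ext (fun x => << Some x >>) (st_star1 k u u')
  | Some _, None => << t >>
  | None, _ => << t' >>
  end.

Definition st_succ1 (k : fieldType) (t t' : stree1) : {malg k[stree1]} :=
  let: SNode a' s' b' := t' in
  lin_ext (fun x => << SNode x s' b' >>) (st_star k (Some t) a').

Definition st_prec1 (k : fieldType) (t t' : stree1) : {malg k[stree1]} :=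
  let: SNode a s b := t in
  lin_ext (fun x => << SNode a s x >>) (st_star k b (Some t')).

Definition st_bullet1 (k : fieldType) (t t' : stree1) : {malg k[stree1]} :=
  let: SNode a s b := t in
  let: SNode a' s' b' := t' in
  lin_ext (fun x => << SNode a (s ++ x :: s') b' >>) (st_star k b a').

Lemma st_star1E (k : fieldType) (t t' : stree1) :
  st_star1 k t t' = st_prec1 k t t' + st_succ1 k t t' + st_bullet1 k t t'.
Proof. by case: t => a s [b|]; case: t' => [[a'|] s' b']. Qed.

Definition st_succ (k : fieldType) : ST k -> ST k -> ST k :=
  bilin_ext (st_succ1 k).
Definition st_prec (k : fieldType) : ST k -> ST k -> ST k :=
  bilin_ext (st_prec1 k).
Definition st_bullet (k : fieldType) : ST k -> ST k -> ST k :=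
  bilin_ext (st_bullet1 k).
Definition st_preceq (k : fieldType) (x y : ST k) : ST k :=
  st_prec x y + st_bullet x y.

Fixpoint pbt_star1 (k : fieldType) (t : ptree1) {struct t} :
    ptree1 -> {malg k[ptree1]} :=
  fix pbt_star1_t (t' : ptree1) {struct t'} : {malg k[ptree1]} :=
  let: PNode a b := t in
  let: PNode a' b' := t' in
  let inj := lin_ext (fun u : ptree1 => << Some u >> : {malg k[ptree]}) in
  lin_ext (fun x : ptree => << PNode a x >>)
    (if b is Some u then inj (pbt_star1 k u t') else << Some t' >>)
  + lin_ext (fun x : ptree => << PNode x b' >>)
    (if a' is Some u' then inj (pbt_star1_t u') else << Some t >>).

Definition pbt_star (k : fieldType) (t t' : ptree) : {malg k[ptree]} :=
  match t, t' with
  | Some u, Some u' => lin_ext (fun x => << Some x >>) (pbt_star1 k u u')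
  | Some _, None => << t >>
  | None, _ => << t' >>
  end.

Definition pbt_succ1 (k : fieldType) (t t' : ptree1) : {malg k[ptree1]} :=
  let: PNode a' b' := t' in
  lin_ext (fun x => << PNode x b' >>) (pbt_star k (Some t) a').

Definition pbt_prec1 (k : fieldType) (t t' : ptree1) : {malg k[ptree1]} :=
  let: PNode a b := t in
  lin_ext (fun x => << PNode a x >>) (pbt_star k b (Some t')).

Lemma pbt_star1E (k : fieldType) (t t' : ptree1) :
  pbt_star1 k t t' = pbt_prec1 k t t' + pbt_succ1 k t t'.
Proof. by case: t => a [b|]; case: t' => [[a'|] b']. Qed.

Definition pbt_succ (k : fieldType) : PBT k -> PBT k -> PBT k :=
  bilin_ext (pbt_succ1 k).
Definition pbt_prec (k : fieldType) : PBT k -> PBT k -> PBT k :=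
  bilin_ext (pbt_prec1 k).

Definition mapi (A B : Type) (f : nat -> A -> B) :=
  fix mapi (i : nat) (s : seq A) : seq B :=
  if s is x :: s' then f i x :: mapi i.+1 s' else [::].

(* The address of a vertex is the list of the ranks (from 0) of the children
   followed to reach it from the root; an edge is identified with the address
   of its upper extremity. *)
Fixpoint redges_seq (t : stree1) : seq (seq nat) :=
  let: SNode a s b := t in
  let up i (x : stree) :=
    if x is Some u then [seq i :: e | e <- redges_seq u] else [::] in
  up 0%N a ++ flatten (mapi up 1 s) ++ up (size s).+1 b
  ++ (if b is Some _ then [:: [:: (size s).+1]] else [::]).

Definition redges (t : stree1) : {fset seq nat} :=
  [fset e in redges_seq t].

(* Contraction of the edges of I, for I included in [redges t]: only rightmost
   edges are ever contracted. *)
Fixpoint contract_pred (I : pred (seq nat)) (t : stree1) : stree1 :=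
  let: SNode a s b := t in
  let sub i (x : stree) := omap (contract_pred (fun e => I (i :: e))) x in
  let n := (size s).+1 in
  match I [:: n], sub n b with
  | true, Some (SNode a' s' b') =>
      SNode (sub 0%N a) (mapi sub 1 s ++ a' :: s') b'
  | _, b' => SNode (sub 0%N a) (mapi sub 1 s) b'
  end.

Definition contract (t : stree1) (I : {fset seq nat}) : stree1 :=
  contract_pred (fun e => e \in I) t.

Definition stree_le (t' t : stree1) : Prop :=
  exists2 I : {fset seq nat}, I `<=` redges t & t' = contract t I.

Definition lower_set (t : stree1) : {fset stree1} :=
  [fset contract t I | I in fpowerset (redges t)].

Lemma lower_setP (t' t : stree1) :
  reflect (stree_le t' t) (t' \in lower_set t).
Proof.
apply: (iffP (imfsetP _ _ _ _)) => [[I /= It ->]|[I It ->]]; exists I => //=.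
  by rewrite fpowersetE in It.
by rewrite fpowersetE.
Qed.

Definition psi (k : fieldType) : {linear PBT k -> ST k} :=
  lin_ext (fun t : ptree1 =>
    \sum_(t' <- lower_set (schroeder1 t)) (<< t' >> : {malg k[stree1]})).

Definition maxw (w : seq nat) : nat := \max_(a <- w) a.

Definition packed (w : seq nat) : bool :=
  (0%N \notin w) && all (fun i => i \in w) (iota 1 (maxw w)).

Definition Pack (u : seq nat) : seq nat :=
  [seq count (fun b => (b <= a)%N) (undup u) | a <- u].

Lemma undup_letters (w : seq nat) : packed w -> undup w =i iota 1 (maxw w).
Proof.
case/andP=> w0 /allP win i; rewrite mem_undup; apply/idP/idP => [iw|/win//].
rewrite mem_iota add1n ltnS lt0n; apply/andP; split.
  by apply: contraNneq w0 => <-.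
by rewrite /maxw; apply: (@leq_bigmax_seq _ w xpredT (fun a => a)).
Qed.

Lemma maxw_leq (w : seq nat) (m : nat) :
  reflect (forall a, a \in w -> (a <= m)%N) (maxw w <= m)%N.
Proof.
apply: (iffP idP) => [le_m a aw|le_m]; last first.
  by rewrite /maxw big_seq; elim/big_ind: _ => // x y; rewrite geq_max => -> ->.
by apply: leq_trans le_m; apply: (@leq_bigmax_seq _ w xpredT (fun a => a)).
Qed.

Lemma maxw_in (w : seq nat) : packed w -> w != [::] -> maxw w \in w.
Proof.
move=> pw w_neq0; rewrite -mem_undup (undup_letters pw) mem_iota add1n leqnn.
case: w pw w_neq0 => // a w /andP[a0 _] _; rewrite andbT.
apply: leq_trans (_ : a <= _)%N; last by apply/(maxw_leq _ _): (mem_head a w).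
by rewrite lt0n; apply: contraNneq a0 => ->; rewrite mem_head.
Qed.

Lemma maxw_size (w : seq nat) : packed w -> (maxw w <= size w)%N.
Proof.
move=> pw; rewrite -(size_iota 1 (maxw w)).
apply: uniq_leq_size (iota_uniq _ _) _ => i.
by rewrite -undup_letters ?mem_undup.
Qed.

Lemma size_Pack (u : seq nat) : size (Pack u) = size u.
Proof. exact: size_map. Qed.

Lemma packed_Pack (u : seq nat) : packed (Pack u).
Proof.
pose s := sort leq (undup u); pose r a := count (fun b => (b <= a)%N) s.
have PackE : Pack u = map r u.
  by apply: eq_map => a; apply/permP; rewrite perm_sym perm_sort.
have mem_s a : (a \in s) = (a \in u) by rewrite mem_sort mem_undup.
have lt_s : sorted ltn s.
  rewrite ltn_sorted_uniq_leq sort_uniq undup_uniq.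
  exact: (sort_sorted leq_total).
have r_nth i : (i < size s)%N -> r (nth 0%N s i) = i.+1.
  move=> lt_i; rewrite /r -[X in count _ X](cat_take_drop i.+1 s) count_cat.
  have lt_nth := sorted_ltn_nth ltn_trans 0%N lt_s.
  have -> : count (fun b => (b <= nth 0%N s i)%N) (take i.+1 s) = i.+1.
    rewrite (eq_in_count (a2 := predT)) ?count_predT ?size_takel // => b.
    case/(nthP 0%N) => j; rewrite size_takel // ltnS => le_ji <-.
    rewrite nth_take ?ltnS //; move: le_ji; rewrite leq_eqVlt.
    case/predU1P=> [->|lt_ji]; first exact: leqnn.
    by apply/ltnW/lt_nth => //; rewrite inE (ltn_trans lt_ji).
  rewrite (eq_in_count (a2 := pred0)) ?count_pred0 ?addn0 // => b.
  case/(nthP 0%N) => j; rewrite size_drop nth_drop => lt_j <-.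
  have lt_ij : (i.+1 + j < size s)%N by rewrite -ltn_subRL.
  by apply: ltn_geF; apply: lt_nth; rewrite ?inE // addSn ltnS leq_addr.
rewrite /packed PackE; apply/andP; split.
  apply/mapP=> -[a au /esym/eqP]; rewrite -leqn0 leqNgt -has_count.
  by case/hasP; exists a; rewrite ?mem_s.
apply/allP=> i; rewrite mem_iota add1n ltnS => /andP[i_gt0 le_i].
have lt_i : (i.-1 < size s)%N.
  rewrite prednK //; apply: leq_trans le_i _; apply/maxw_leq=> _ /mapP[a _ ->].
  exact: count_size.
apply/mapP; exists (nth 0%N s i.-1); first by rewrite -mem_s mem_nth.
by rewrite r_nth // prednK.
Qed.

Record pword : Type := PWord {
  pword_val :> seq nat;
  pwordP : packed pword_val && (pword_val != [::])
}.

HB.instance Definition _ := [isSub for pword_val].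
HB.instance Definition _ := [Countable of pword by <:].

Definition QSh (k : fieldType) : lmodType k := {malg k[pword]}.

(* The default value in insubd is never used when 0 < i < maxw w; see
   restrictE and pack_restE. *)
Definition restrict (w : pword) (i : nat) : pword :=
  insubd w [seq a <- val w | (a <= i)%N].

Definition pack_rest (w : pword) (i : nat) : pword :=
  insubd w (Pack [seq a <- val w | (i < a)%N]).

Lemma restrictE (w : pword) (i : nat) : (0 < i)%N ->
  val (restrict w i) = [seq a <- val w | (a <= i)%N].
Proof.
move=> i_gt0; rewrite /restrict insubdK // -topredE /=.
have /andP[pw w_neq0] := pwordP w; have /andP[w0 win] := pw.
have win1 : 1%N \in val w.
  move/allP: win; apply; rewrite mem_iota add1n ltnS /=.
  by move: (maxw_in pw w_neq0); case: (maxw w) => //; rewrite (negPf w0).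
apply/andP; split; last first.
  by rewrite -has_filter; apply/hasP; exists 1%N.
rewrite /packed mem_filter (negPf w0) andbF /=; apply/allP=> j.
rewrite mem_iota add1n ltnS mem_filter => /andP[j_gt0 le_j].
apply/andP; split.
  by apply: leq_trans le_j _; apply/maxw_leq=> a; rewrite mem_filter => /andP[].
move/allP: win; apply; rewrite mem_iota j_gt0 add1n ltnS.
apply: leq_trans le_j _; apply/maxw_leq=> a; rewrite mem_filter => /andP[_].
by move: a; apply/maxw_leq.
Qed.

Lemma pack_restE (w : pword) (i : nat) : (i < maxw w)%N ->
  val (pack_rest w i) = Pack [seq a <- val w | (i < a)%N].
Proof.
move=> lt_i; rewrite /pack_rest insubdK // -topredE /=.
rewrite packed_Pack /= -size_eq0 size_Pack size_eq0 -has_filter.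
have /andP[pw w_neq0] := pwordP w.
by apply/hasP; exists (maxw w); first exact: maxw_in.
Qed.

Definition qsh_dprec (k : fieldType) : 
    {linear QSh k -> tensor k pword pword} :=
  lin_ext (fun w : pword =>
    \sum_(head 0%N (val w) <= i < maxw w) << (restrict w i, pack_rest w i) >>).

Definition qsh_dsucc (k : fieldType) : 
    {linear QSh k -> tensor k pword pword} :=
  lin_ext (fun w : pword =>
    \sum_(1 <= i < head 0%N (val w)) << (restrict w i, pack_rest w i) >>).

(* u_1, ..., u_(q+1) when w = u_1 1 u_2 1 ... 1 u_(q+1). *)
Fixpoint split_ones (w : seq nat) : seq (seq nat) :=
  if w is a :: w' then
    if a == 1%N then [::] :: split_ones w'
    else (a :: head [::] (split_ones w')) :: behead (split_ones w')
  else [:: [::]].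

(* n is only a bound on the recursion depth; see rhoE. *)
Fixpoint rho_rec (n : nat) (w : seq nat) : stree :=
  match n, w with
  | n'.+1, _ :: _ => graft [seq rho_rec n' (Pack u) | u <- split_ones w]
  | _, _ => None
  end.

Definition rho (w : seq nat) : stree := rho_rec (size w) w.

Lemma split_ones_flatten (w : seq nat) :
  (sumn [seq (size u).+1 | u <- split_ones w] = (size w).+1)%N.
Proof.
elim: w => //= a w IH; case: ifP => _ /=; first by rewrite IH.
by move: IH; case: (split_ones w) => //= u s; rewrite !addSn => [[->]].
Qed.

Lemma size_split_ones (w : seq nat) :
  size (split_ones w) = (count_mem 1%N w).+1.
Proof.
elim: w => //= a w IH; rewrite eq_sym; case: ifP => _ /=; first by rewrite IH.
by rewrite size_behead IH.
Qed.

Lemma split_ones_notin (w : seq nat) :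
  1%N \notin w -> split_ones w = [:: w].
Proof.
elim: w => //= a w IH; rewrite inE negb_or eq_sym => /andP[/negPf-> /IH->].
by [].
Qed.

Lemma split_ones_size (w u : seq nat) :
  1%N \in w -> u \in split_ones w -> (size u < size w)%N.
Proof.
rewrite -has_pred1 has_count => w1 /rot_index; set i := index _ _ => Er.
have: perm_eq (split_ones w) (u :: behead (rot i (split_ones w))).
  by rewrite -(perm_rot i) Er.
move=> p; move: (perm_size p) (split_ones_flatten w) (size_split_ones w) => /=.
rewrite (perm_sumn (perm_map _ p)) /=.
case: (behead _) => [|v s] /= -> ; first by move=> _ [] E; rewrite -E in w1.
by rewrite !addSn => -[<-] _; rewrite addnS ltnS leq_addr.
Qed.

Lemma rho_recE (n : nat) (w : seq nat) :
  (size w <= n)%N -> rho_rec n w = rho w.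
Proof.
rewrite /rho; move: {2 4}(size w) (leqnn (size w)) => m.
elim: n m w => [|n IH] [|m] [|a w] //=; rewrite !ltnS => le_m le_n.
case: (boolP (1%N \in a :: w)) => [w1|].
  congr graft; apply/eq_in_map => u uw; apply: IH; rewrite size_Pack -ltnS.
    exact: leq_trans (split_ones_size w1 uw) _.
  exact: leq_trans (split_ones_size w1 uw) _.
by move/split_ones_notin=> /= ->.
Qed.

Lemma rhoE (w : seq nat) :
  w != [::] -> rho w = graft [seq rho (Pack u) | u <- split_ones w].
Proof.
case: w => // a w _; rewrite {1}/rho /=.
case: (boolP (1%N \in a :: w)) => [w1|].
  congr graft; apply/eq_in_map => u uw; apply: rho_recE.
  by rewrite size_Pack -ltnS; apply: (split_ones_size w1 uw).
by move/split_ones_notin=> /= ->.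
Qed.

Lemma leaves_gt0 (t : stree) : (0 < leaves t)%N.
Proof.
case: t => //; elim/stree1_nested_ind => a s b Ha _ _ /=.
by rewrite -addnA addn_gt0; case: a Ha => //= u ->.
Qed.

Lemma leaves_graft (ts : seq stree) :
  (1 < size ts)%N -> leaves (graft ts) = sumn (map leaves ts).
Proof.
case: ts => [|a [|x s]] // _; rewrite /= -/leaves.
rewrite -addnA; congr (_ + _)%N; apply: esym.
transitivity (sumn (map leaves (x :: s))); first by [].
by rewrite lastI map_rcons sumn_rcons.
Qed.

Lemma degree_rho (w : seq nat) : packed w -> degree (rho w) = size w.
Proof.
move=> pw; suff: leaves (rho w) = (size w).+1 by rewrite /degree => ->.
have [n le_n] := ubnP (size w); elim: n w le_n pw => // n IH w le_n pw.
have [->//|w_neq0] := eqVneq w [::].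
have w1 : 1%N \in w.
  have /andP[w0 /allP win] := pw; apply: win; rewrite mem_iota add1n ltnS /=.
  by move: (maxw_in pw w_neq0); case: (maxw w) => //; rewrite (negPf w0).
rewrite rhoE // leaves_graft.
  rewrite -split_ones_flatten -map_comp; congr sumn; apply/eq_in_map=> u uw /=.
  rewrite IH ?size_Pack ?packed_Pack //.
  exact: leq_trans (split_ones_size w1 uw) _.
by rewrite size_map size_split_ones ltnS -has_count has_pred1.
Qed.

Definition permw (w : seq nat) : bool := perm_eq w (iota 1 (size w)).

(* The nonempty packed words of length n; see mem_pwords. *)
Definition pwords (n : nat) : seq pword :=
  pmap insub [seq map val (val w) | w : n.-tuple 'I_n.+1].

Lemma mem_pwords (n : nat) (w : pword) : (w \in pwords n) = (size w == n).
Proof.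
rewrite /pwords mem_pmap_sub; apply/imageP/eqP => [[u _ ->]|sz].
  by rewrite size_map size_tuple.
have /andP[pw _] := pwordP w.
have szt : size (map (inord : nat -> 'I_n.+1) w) == n by rewrite size_map sz.
exists (Tuple szt) => //=; rewrite -map_comp map_id_in // => a aw /=.
rewrite inordK // ltnS -sz; apply: leq_trans (maxw_size pw).
exact/(maxw_leq _ _).
Qed.

Lemma uniq_pwords (n : nat) : uniq (pwords n).
Proof.
apply: pmap_sub_uniq; rewrite map_inj_uniq ?enum_uniq // => u v.
by move/(inj_map val_inj)/val_inj.
Qed.

(* rho sends a packed word of length n to a tree of degree n, so that the sums
   below range over all packed words, resp. all permutations, that rho sends
   to t; see mcoeff_Omega and mcoeff_Omega_perm. *)
Definition Omega (k : fieldType) : {linear ST k -> QSh k} :=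
  lin_ext (fun t : stree1 =>
    \sum_(w <- pwords (degree (Some t)) | rho (val w) == Some t)
      (<< w >> : {malg k[pword]})).

(* Sh_+ is the submodule of QSh_+ spanned by the permutations. *)
Definition Omega_perm (k : fieldType) : {linear PBT k -> QSh k} :=
  lin_ext (fun t : ptree1 =>
    \sum_(w <- pwords (degree (Some (schroeder1 t)))
            | permw (val w) && (rho (val w) == Some (schroeder1 t)))
      (<< w >> : {malg k[pword]})).

Lemma mcoeff_Omega (k : fieldType) (t : stree1) (w : pword) :
  (Omega k << t >>)@_w = (rho (val w) == Some t)%:R.
Proof.
rewrite /Omega /= lin_extU raddf_sum /= big_mkcond /=.
have [rw|rw] := eqVneq (rho (val w)) (Some t); last first.
  apply: big1 => v _; case: ifP => // rv; rewrite mcoeffU.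
  by case: eqP => // vw; rewrite -vw rv in rw.
have wP : w \in pwords (degree (Some t)).
  by rewrite mem_pwords -rw degree_rho //; case/andP: (pwordP w).
rewrite (bigD1_seq w) ?uniq_pwords //= rw eqxx mcoeffUU big1 ?addr0 // => v vw.
by case: ifP => // _; rewrite mcoeffU (negPf vw).
Qed.

Lemma mcoeff_Omega_perm (k : fieldType) (t : ptree1) (w : pword) :
  (Omega_perm k << t >>)@_w =
    (permw (val w) && (rho (val w) == Some (schroeder1 t)))%:R.
Proof.
rewrite /Omega_perm /= lin_extU raddf_sum /= big_mkcond /=.
have [|rw] := boolP (_ && _); last first.
  apply: big1 => v _; case: ifP => // rv; rewrite mcoeffU.
  by case: eqP => // vw; rewrite -vw rv in rw.
case/andP=> pw /eqP rw.
have wP : w \in pwords (degree (Some (schroeder1 t))).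
  by rewrite mem_pwords -rw degree_rho //; case/andP: (pwordP w).
rewrite (bigD1_seq w) ?uniq_pwords //= rw pw eqxx mcoeffUU.
rewrite big1 ?addr0 // => v vw.
by case: ifP => // _; rewrite mcoeffU (negPf vw).
Qed.

(* Main.v *)
(** psi is the transpose of the map [binarize1] that expands every vertex of a
    Schroeder tree into a right comb: the lower set of a binary tree t is the
    fibre of [binarize1] over t, so the coefficient of t' in psi x is the
    coefficient of [binarize1 t'] in x, and psi is injective.

    Products: extended to the unit, psi sends a \/ b to the bilinear expression
    [stree_join] in psi a and psi b (the right edge at the root is kept or
    contracted), whose compatibility with the products gives the morphism
    property by induction.

    Coproducts: the coefficient of (w1, w2) in the coproduct of y is the sum of
    the coefficients of y at the shuffles of w1 with the shifted w2.  The tree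
    binarize (rho w) is the Cartesian tree of w (root at the leftmost minimum), so
    it is unchanged when w is replaced by its standardization, and
    standardization commutes with these shuffles. *)

Require Import Defs.
From HB Require Import structures.
From mathcomp Require Import all_boot all_order all_algebra finmap.
From mathcomp Require Import monalg zify.

Set Implicit Arguments.
Unset Strict Implicit.
Unset Printing Implicit Defensive.

Import GRing.Theory.
Local Open Scope ring_scope.

(** * Free modules and transposes of maps between bases *)

Lemma malg_ind (k : fieldType) (B : choiceType) (P : {malg k[B]} -> Prop) :
  P 0 -> (forall c x y, P x -> P y -> P (c *: x + y)) ->
  (forall b, P << b >>) -> forall x, P x.
Proof.
move=> P0 PD PU x; rewrite [x]monalgE; elim/big_rec: _ => // b y _ Py.
suff -> : << x@_b *g b >> = x@_b *: << b >> by apply: PD.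
by apply/malgP=> c; rewrite mcoeffZ !mcoeffU mulrnAr mulr1.
Qed.

Lemma linear_lin_ext (k : fieldType) (B : choiceType) (V W : lmodType k)
    (g : {linear V -> W}) (f : B -> V) (x : {malg k[B]}) :
  g (lin_ext f x) = lin_ext (g \o f) x.
Proof. by rewrite /lin_ext linear_sum; apply: eq_bigr => b _; rewrite linearZ. Qed.

Lemma lin_extE (k : fieldType) (B : choiceType) (V : lmodType k)
    (f : B -> V) (x : {malg k[B]}) :
  lin_ext f x = \sum_(b <- msupp x) x@_b *: f b.
Proof. by []. Qed.

Lemma bilin_extPl (k : fieldType) (B C : choiceType) (V : lmodType k)
    (f : B -> C -> V) c x x' y :
  bilin_ext f (c *: x + x') y = c *: bilin_ext f x y + bilin_ext f x' y.
Proof. exact: linearP. Qed.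

Lemma bilin_extPr (k : fieldType) (B C : choiceType) (V : lmodType k)
    (f : B -> C -> V) c x y y' :
  bilin_ext f x (c *: y + y') = c *: bilin_ext f x y + bilin_ext f x y'.
Proof.
rewrite /bilin_ext !(lin_extE _ x) scaler_sumr -big_split; apply: eq_bigr => b _ /=.
by rewrite linearP scalerDr !scalerA mulrC.
Qed.

Lemma bilin_ext0l (k : fieldType) (B C : choiceType) (V : lmodType k)
    (f : B -> C -> V) y : bilin_ext f 0 y = 0.
Proof. exact: linear0. Qed.

Lemma bilin_ext0r (k : fieldType) (B C : choiceType) (V : lmodType k)
    (f : B -> C -> V) x : bilin_ext f x 0 = 0.
Proof.
by rewrite /bilin_ext (lin_extE _ x) big1 // => b _; rewrite linear0 scaler0.
Qed.

Lemma bilin_extUl (k : fieldType) (B C : choiceType) (V : lmodType k)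
    (f : B -> C -> V) b y : bilin_ext f << b >> y = lin_ext (f b) y.
Proof. exact: lin_extU. Qed.

Lemma bilin_extUr (k : fieldType) (B C : choiceType) (V : lmodType k)
    (f : B -> C -> V) x c : bilin_ext f x << c >> = lin_ext (f^~ c) x.
Proof.
by rewrite /bilin_ext !(lin_extE _ x); apply: eq_bigr => b _; rewrite lin_extU.
Qed.

Lemma bilin_extUU (k : fieldType) (B C : choiceType) (V : lmodType k)
    (f : B -> C -> V) b c : bilin_ext f << b >> << c >> = f b c.
Proof. by rewrite bilin_extUl lin_extU. Qed.

(* [lin_dual f F] says that f is the transpose of the partial map F between
   the bases: F c is the only basis element whose image involves c. *)
Definition lin_dual (k : fieldType) (B C : choiceType)
    (f : {malg k[B]} -> {malg k[C]}) (F : C -> option B) : Prop :=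
  forall x c, (f x)@_c = oapp (fun b => x@_b) 0 (F c).

Lemma lin_dualP (k : fieldType) (B C : choiceType)
    (f : {linear {malg k[B]} -> {malg k[C]}}) (F : C -> option B) :
  (forall b c, (f << b >>)@_c = (F c == Some b)%:R) -> lin_dual f F.
Proof.
move=> fF; elim/malg_ind=> [c|a x y IHx IHy c|b c].
- by rewrite linear0 mcoeff0; case: (F c) => //= b; rewrite mcoeff0.
- rewrite linearP mcoeffD mcoeffZ IHx IHy.
  by case: (F c) => [b|] /=; rewrite ?mcoeffD ?mcoeffZ // mulr0 addr0.
- rewrite fF; case: (F c) => //= b'.
  by rewrite mcoeffU (inj_eq Some_inj) eq_sym.
Qed.

(** The bilinear counterpart of [lin_dualP], with [F] total: it serves [tens], where [F] is the
    identity, and [stree_join], where [F] splits a tree at its root. *)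
Lemma mcoeff_bilin_ext (k : fieldType) (B C D : choiceType)
    (f : B -> C -> {malg k[D]}) (F : D -> B * C) :
  (forall b c d, (f b c)@_d = (F d == (b, c))%:R) ->
  forall x y d, (bilin_ext f x y)@_d = x@_(F d).1 * y@_(F d).2.
Proof.
move=> fF x y d; elim/malg_ind: x => [|a x x' IHx IHx'|b].
- by rewrite bilin_ext0l !mcoeff0 mul0r.
- by rewrite bilin_extPl !mcoeffD !mcoeffZ IHx IHx' mulrDl mulrA.
elim/malg_ind: y => [|a y y' IHy IHy'|c].
- by rewrite bilin_ext0r !mcoeff0 mulr0.
- by rewrite bilin_extPr !mcoeffD !mcoeffZ IHy IHy' mulrDr mulrCA.
rewrite bilin_extUU fF !mcoeffU -natrM mulnb (eq_sym b) (eq_sym c).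
by case: (F d).
Qed.

Lemma mcoeff_tens (k : fieldType) (B C : choiceType)
    (x : {malg k[B]}) (y : {malg k[C]}) p :
  (tens x y)@_p = x@_p.1 * y@_p.2.
Proof.
by apply: (mcoeff_bilin_ext (F := id)) => b c d; rewrite mcoeffU eq_sym.
Qed.

Lemma tensmap_dual (k : fieldType) (B C B' C' : choiceType)
    (f : {malg k[B]} -> {malg k[B']}) (g : {malg k[C]} -> {malg k[C']})
    (F : B' -> option B) (G : C' -> option C) :
  lin_dual f F -> lin_dual g G ->
  lin_dual (tensmap f g)
    (fun p => if F p.1 is Some b then omap (pair b) (G p.2) else None).
Proof.
move=> fF gG; apply: lin_dualP => -[b c] [b' c'] /=.
rewrite /tensmap /= lin_extU mcoeff_tens fF gG /=.
case: (F b') => [d|]; case: (G c') => [e|] //=; rewrite ?mul0r ?mulr0 //.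
by rewrite !mcoeffU -natrM mulnb (eq_sym b) (eq_sym c).
Qed.

(** The coefficient at [(b, b')] is read off at a pair of preimages under [F]. This is what cancels
    [Omega] on both tensor factors. *)
Lemma tensmap_inj (k : fieldType) (B C : choiceType)
    (f : {malg k[B]} -> {malg k[C]}) (F : C -> option B) :
  lin_dual f F -> (forall b, exists c, F c = Some b) ->
  injective (tensmap f f).
Proof.
move=> fF F_surj x y /malgP xy; apply/malgP=> -[b b'].
have [[c Fc] [c' Fc']] := (F_surj b, F_surj b').
by have := xy (c, c'); rewrite !(tensmap_dual fF fF) /= Fc Fc'.
Qed.

(** * Lower sets as fibres *)

(* The binary tree obtained by expanding every vertex t_1 \/ ... \/ t_m into
   the right comb t_1 \/ (t_2 \/ (... \/ t_m)). *)
Fixpoint binarize1 (t : stree1) : ptree1 :=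
  let: SNode a s b := t in
  let bin := omap binarize1 in
  PNode (bin a) (foldr (fun x y => Some (PNode (bin x) y)) (bin b) s).

Definition binarize : stree -> ptree := omap binarize1.

(** What is left of a vertex once its first child is split off: the other children on a vertex of
    their own, or the last child itself if it is alone. *)
Definition right_part (s : seq stree) (b : stree) : stree :=
  if s is c :: s' then Some (SNode c s' b) else b.

Lemma binarize1E a s b :
  binarize1 (SNode a s b) = PNode (binarize a) (binarize (right_part s b)).
Proof. by case: s. Qed.

Lemma schroeder1K : cancel schroeder1 binarize1.
Proof.
elim/ptree1_nested_ind=> -[a|] [b|] //= Ha Hb; congr (PNode _ _);
  by rewrite /= ?Ha ?Hb.
Qed.

Lemma schroederK : cancel (omap schroeder1) binarize.
Proof. by case=> //= t; rewrite schroeder1K. Qed.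

Lemma contract_pred_PNode (I : pred (seq nat)) (a b : ptree) :
  let a' := omap (contract_pred (fun e => I (0%N :: e))) (omap schroeder1 a) in
  let b' := omap (contract_pred (fun e => I (1%N :: e))) (omap schroeder1 b) in
  contract_pred I (schroeder1 (PNode a b)) =
    match I [:: 1%N], b' with
    | true, Some (SNode c s d) => SNode a' (c :: s) d
    | _, _ => SNode a' [::] b'
    end.
Proof. by move=> /=; case: (I _) => //; case: (omap _ (omap _ b)) => [[]|]. Qed.

(** Contracting a right edge replaces the last child of a vertex by the children of that child;
    expansion into a right comb recreates the edge. *)
Lemma contract_pred_binarize1 (t : ptree1) (I : pred (seq nat)) :
  binarize1 (contract_pred I (schroeder1 t)) = t.
Proof.
elim/ptree1_nested_ind: t I => a b Ha Hb I; rewrite contract_pred_PNode.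
have {}Ha J : binarize (omap (contract_pred J) (omap schroeder1 a)) = a.
  by case: a Ha => //= a ->.
have {}Hb J : binarize (omap (contract_pred J) (omap schroeder1 b)) = b.
  by case: b Hb => //= b ->.
have [Ea Eb] := (Ha (fun e => I (0%N :: e)), Hb (fun e => I (1%N :: e))).
case: (I _); last by rewrite binarize1E Ea Eb.
by move: Eb; case: (omap _ (omap _ b)) => [[c s d]|] Eb; rewrite binarize1E Ea Eb.
Qed.

(** Keeps the right edge at the root, of address [[:: 1]], apart from the edges [1 :: e] of the
    right subtree. *)
Lemma nil_notin_redges_seq (t : ptree1) :
  [::] \notin redges_seq (schroeder1 t).
Proof.
have no_nil i (s : seq (seq nat)) : [::] \notin [seq i :: e | e <- s].
  by apply/mapP=> -[].
by case: t => -[a|] [b|] //=; rewrite ?mem_cat ?negb_or ?no_nil.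
Qed.

(** Allows contractions to be built from arbitrary predicates and only afterwards cut down to a
    subset of [redges]. *)
Lemma eq_contract_pred (t : ptree1) (I J : pred (seq nat)) :
  {in redges_seq (schroeder1 t), I =1 J} ->
  contract_pred I (schroeder1 t) = contract_pred J (schroeder1 t).
Proof.
elim/ptree1_nested_ind: t I J => a b Ha Hb I J /= IJ.
have -> : omap (contract_pred (fun e => I (0%N :: e))) (omap schroeder1 a)
  = omap (contract_pred (fun e => J (0%N :: e))) (omap schroeder1 a).
  case: a Ha IJ => //= a IHa IJ; congr Some; apply: IHa => e ea.
  by apply: IJ; rewrite mem_cat map_f.
case: b Hb IJ => [b|] /= IHb IJ; last by case: (I _); case: (J _).
rewrite -(IHb (fun e => I (1%N :: e)) (fun e => J (1%N :: e))).
  by rewrite (IJ [:: 1%N]) // !mem_cat mem_seq1 eqxx !orbT.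
by move=> e eb; apply: IJ; rewrite !mem_cat map_f ?orbT.
Qed.

Lemma contract_pred_surj (t' : stree1) (t : ptree1) :
  binarize1 t' = t -> exists I, contract_pred I (schroeder1 t) = t'.
Proof.
elim/ptree1_nested_ind: t t' => a b Ha Hb [a' s b'].
rewrite binarize1E => -[Ea Eb].
have [Ia EIa] : exists I, omap (contract_pred I) (omap schroeder1 a) = a'.
  case: a a' Ea Ha => [a|] [a'|] //=; last by exists pred0.
  by move=> [Ea] IHa; have [I <-] := IHa _ Ea; exists I.
have [Ib EIb] : exists I,
    omap (contract_pred I) (omap schroeder1 b) = right_part s b'.
  case: b (right_part s b') Eb Hb => [b|] [t'|] //=.
  by move=> [Eb] IHb; have [I <-] := IHb _ Eb; exists I.
(* The right edge at the root is contracted exactly when the root of the target tree has more than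
   two children; deeper addresses go to the two subtrees. *)
exists (fun e => match e with
                 | 0%N :: e' => Ia e'
                 | [:: _] => s != [::]
                 | _ :: e' => Ib e'
                 | [::] => false
                 end).
rewrite contract_pred_PNode /= EIa.
(* The predicate seen by the right subtree can differ from [Ib] only at the empty address, which is
   not an edge. *)
have -> : omap (contract_pred (fun e => if e is [::] then s != [::] else Ib e))
    (omap schroeder1 b) = right_part s b'.
  rewrite -EIb; case: (b) => //= b1; congr Some; apply: eq_contract_pred.
  by case=> // /idPn[]; exact: nil_notin_redges_seq.
by case: (s) => [|c s'].
Qed.

Lemma mem_lower_set (t' : stree1) (t : ptree1) :
  (t' \in lower_set (schroeder1 t)) = (binarize1 t' == t).
Proof.
apply/lower_setP/eqP => [[I _ ->]|/contract_pred_surj[I <-]].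
  exact: contract_pred_binarize1.
exists [fset e in redges_seq (schroeder1 t) | I e]%fset.
  by apply/fsubsetP=> e; rewrite !inE /= => /andP[].
by apply: eq_contract_pred => e et; rewrite !inE /= et.
Qed.

Lemma psi_dual (k : fieldType) : lin_dual (psi k) (Some \o binarize1).
Proof.
apply: lin_dualP => t t' /=; rewrite /psi /= lin_extU raddf_sum /=.
rewrite (inj_eq Some_inj) -mem_lower_set.
have [t'_le|t'_nle] := boolP (t' \in _).
  rewrite (bigD1_seq t') ?fset_uniq //= mcoeffUU big1 ?addr0 // => u.
  by rewrite mcoeffU => /negPf->.
rewrite big_seq big1 // => u ut; rewrite mcoeffU.
by case: eqP ut t'_nle => // -> ->.
Qed.

Lemma psi_inj (k : fieldType) : injective (psi k).
Proof.
move=> x y /malgP xy; apply/malgP=> t.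
by have := xy (schroeder1 t); rewrite !psi_dual /= schroeder1K.
Qed.

(** * The products *)

Definition psi0 (k : fieldType) : {linear {malg k[ptree]} -> {malg k[stree]}} :=
  lin_ext (fun a : ptree =>
    if a is Some t then lin_ext (fun u => << Some u >>) (psi k << t >>)
    else << None >>).

Lemma psi0_Some (k : fieldType) (x : {malg k[ptree1]}) :
  psi0 k (lin_ext (fun t => << Some t >>) x)
  = lin_ext (fun u => << Some u >>) (psi k x).
Proof.
elim/malg_ind: x => [|c x y IHx IHy|t]; first by rewrite !linear0.
  by rewrite !linearP IHx IHy.
by rewrite lin_extU; apply: lin_extU.
Qed.

Lemma mcoeff_lin_ext_Some (k : fieldType) (B : choiceType)
    (x : {malg k[B]}) (o : option B) :
  (lin_ext (fun u => << Some u >> : {malg k[option B]}) x)@_o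
  = oapp (fun b => x@_b) 0 o.
Proof.
move: x o; apply: (lin_dualP (F := id)) => b o.
by rewrite /= lin_extU mcoeffU eq_sym.
Qed.

Lemma psi0_dual (k : fieldType) : lin_dual (psi0 k) (Some \o binarize).
Proof.
apply: lin_dualP => a t; rewrite /psi0 /= lin_extU (inj_eq Some_inj).
case: a => [a|]; last by rewrite mcoeffU eq_sym; case: t.
rewrite mcoeff_lin_ext_Some; case: t => //= t; rewrite psi_dual /=.
by rewrite mcoeffU eq_sym.
Qed.

(* The edge going up to the right child is either kept or contracted. *)
Definition stree_join (k : fieldType) :
    {malg k[stree]} -> {malg k[stree]} -> ST k :=
  bilin_ext (fun a b => << SNode a [::] b >>
    + (if b is Some (SNode c s d) then << SNode a (c :: s) d >> else 0)).

(** A first child and a right part other than a leaf determine two trees, according to whether the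
    right part keeps its own vertex or shares the root; these are the two summands of
    [stree_join]. *)
Lemma mcoeff_stree_join (k : fieldType) (x y : {malg k[stree]}) a s b :
  (stree_join x y)@_(SNode a s b) = x@_a * y@_(right_part s b).
Proof.
pose F t := let: SNode a s b := t in (a, right_part s b).
apply: (mcoeff_bilin_ext (F := F)) => c d [a' s' b'] /=.
rewrite mcoeffD mcoeffU.
(* Without middle children only the summand with the edge kept contributes, otherwise only the
   contracted one. *)
case: s' => [|e s'] /=.
  rewrite (_ : _@__ = 0) ?addr0; last first.
    by case: d => [[? ? ?]|]; rewrite ?mcoeff0 // mcoeffU; case: eqP => // -[].
  congr (_%:R); congr (nat_of_bool _); rewrite eq_sym.
  by apply/eqP/eqP=> -[-> ->].
rewrite [X in X + _](_ : _ = 0) ?add0r; last by case: eqP => // -[].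
case: d => [[c1 s1 d1]|]; last by rewrite mcoeff0; case: eqP.
rewrite mcoeffU; congr (_%:R); congr (nat_of_bool _); rewrite eq_sym.
by apply/eqP/eqP=> -[-> -> -> ->].
Qed.

(** Coefficientwise this is [binarize1E]: a tree expands to [PNode a b] exactly when its first child
    expands to [a] and its right part to [b]. *)
Lemma psi_PNode (k : fieldType) (a b : ptree) :
  psi k << PNode a b >> = stree_join (psi0 k << a >>) (psi0 k << b >>).
Proof.
apply/malgP=> -[a' s b']; rewrite mcoeff_stree_join !psi0_dual psi_dual.
rewrite [oapp _ _ _]/(_@_(binarize1 (SNode a' s b'))) binarize1E [RHS]/=.
rewrite !mcoeffU -natrM mulnb.
have <- : (PNode a b == PNode (binarize a') (binarize (right_part s b')))
  = (a == binarize a') && (b == binarize (right_part s b')).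
  by apply/eqP/andP=> [[-> ->]|[/eqP-> /eqP->]].
exact: mcoeffU.
Qed.

Lemma lin_extD (k : fieldType) (B : choiceType) (V : lmodType k)
    (f g : B -> V) (x : {malg k[B]}) :
  lin_ext (fun b => f b + g b) x = lin_ext f x + lin_ext g x.
Proof. by rewrite /lin_ext -big_split; apply: eq_bigr => b _; rewrite scalerDr. Qed.

Lemma lin_ext0 (k : fieldType) (B : choiceType) (V : lmodType k) (x : {malg k[B]}) :
  lin_ext (fun=> 0) x = 0 :> V.
Proof. by rewrite /lin_ext big1 // => b _; rewrite scaler0. Qed.

Lemma lin_ext_lin_extU (k : fieldType) (B C : choiceType) (V : lmodType k)
    (f : C -> V) (h : B -> C) (x : {malg k[B]}) :
  lin_ext f (lin_ext (fun b => << h b >>) x) = lin_ext (f \o h) x.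
Proof.
rewrite linear_lin_ext [RHS]/lin_ext; apply: eq_bigr => b _ /=.
by rewrite lin_extU.
Qed.

Definition st_starL (k : fieldType) :
    {malg k[stree]} -> {malg k[stree]} -> {malg k[stree]} :=
  bilin_ext (st_star k).

Lemma bilin_extD (k : fieldType) (B C : choiceType) (V : lmodType k)
    (f g : B -> C -> V) (x : {malg k[B]}) (y : {malg k[C]}) :
  bilin_ext (fun b c => f b c + g b c) x y = bilin_ext f x y + bilin_ext g x y.
Proof.
rewrite /bilin_ext -lin_extD !(lin_extE _ x).
by apply: eq_bigr => b _; rewrite lin_extD.
Qed.

Lemma bilin_ext_lin_extUl (k : fieldType) (B C D : choiceType) (V : lmodType k)
    (f : C -> D -> V) (h : B -> C) (x : {malg k[B]}) (y : {malg k[D]}) :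
  bilin_ext f (lin_ext (fun b => << h b >>) x) y
  = bilin_ext (fun b d => f (h b) d) x y.
Proof. exact: lin_ext_lin_extU. Qed.

Lemma bilin_ext_lin_extUr (k : fieldType) (B C D : choiceType) (V : lmodType k)
    (f : B -> D -> V) (h : C -> D) (x : {malg k[B]}) (y : {malg k[C]}) :
  bilin_ext f x (lin_ext (fun c => << h c >>) y)
  = bilin_ext (fun b c => f b (h c)) x y.
Proof.
rewrite /bilin_ext !(lin_extE _ x).
by apply: eq_bigr => b _; rewrite lin_ext_lin_extU.
Qed.

Lemma lin_ext_bilin_ext (k : fieldType) (B C D : choiceType) (V : lmodType k)
    (g : D -> V) (f : B -> C -> {malg k[D]}) (x : {malg k[B]}) (y : {malg k[C]}) :
  lin_ext g (bilin_ext f x y) = bilin_ext (fun b c => lin_ext g (f b c)) x y.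
Proof.
rewrite linear_lin_ext /bilin_ext !(lin_extE _ x).
by apply: eq_bigr => b _; congr (_ *: _); apply: linear_lin_ext.
Qed.

Lemma eq_bilin_ext (k : fieldType) (B C : choiceType) (V : lmodType k)
    (f g : B -> C -> V) (x : {malg k[B]}) (y : {malg k[C]}) :
  (forall b c, f b c = g b c) -> bilin_ext f x y = bilin_ext g x y.
Proof.
move=> fg; rewrite /bilin_ext !(lin_extE _ x); apply: eq_bigr => b _.
by rewrite !(lin_extE _ y); congr (_ *: _); apply: eq_bigr => c _; rewrite fg.
Qed.

(** By trilinearity a mixed associativity law need only be checked on basis elements; both
    compatibilities of [stree_join] with the products have this shape. *)
Lemma bilin_ext_assoc (k : fieldType) (B C D E F : choiceType) (V : lmodType k)
    (f : E -> D -> V) (g : B -> C -> {malg k[E]})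
    (f' : B -> F -> V) (g' : C -> D -> {malg k[F]})
    (x : {malg k[B]}) (y : {malg k[C]}) (z : {malg k[D]}) :
  (forall b c d, lin_ext (f^~ d) (g b c) = lin_ext (f' b) (g' c d)) ->
  bilin_ext f (bilin_ext g x y) z = bilin_ext f' x (bilin_ext g' y z).
Proof.
move=> fg; elim/malg_ind: x => [|a x x' IHx IHx'|b].
- by rewrite !bilin_ext0l.
- by rewrite !bilin_extPl IHx IHx'.
elim/malg_ind: y => [|a y y' IHy IHy'|c].
- by rewrite bilin_ext0l bilin_ext0r !bilin_ext0l bilin_ext0r.
- by rewrite bilin_extPr !bilin_extPl bilin_extPr IHy IHy'.
elim/malg_ind: z => [|a z z' IHz IHz'|d].
- by rewrite !bilin_ext0r.
- by rewrite !bilin_extPr IHz IHz'.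
by rewrite !bilin_extUU bilin_extUr bilin_extUl fg.
Qed.

Lemma st_preceqE (k : fieldType) (x y : ST k) :
  st_preceq x y = bilin_ext (fun s t => st_prec1 k s t + st_bullet1 k s t) x y.
Proof. exact: esym (bilin_extD _ _ _ _). Qed.

Lemma st_starL_Some (k : fieldType) (x y : ST k) :
  st_starL (lin_ext (fun t => << Some t >>) x) (lin_ext (fun t => << Some t >>) y)
  = lin_ext (fun t => << Some t >>) (st_preceq x y + st_succ x y).
Proof.
rewrite st_preceqE -bilin_extD lin_ext_bilin_ext.
rewrite /st_starL bilin_ext_lin_extUl bilin_ext_lin_extUr.
apply: eq_bilin_ext => s t; rewrite addrAC -st_star1E.
by [].
Qed.

(** The product [succ] changes only the first child of its right factor, while the choice made by
    [stree_join] concerns only the right edge, so the two commute. *)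
Lemma succ_stree_join (k : fieldType) (x : ST k) (u y : {malg k[stree]}) :
  st_succ x (stree_join u y)
  = stree_join (st_starL (lin_ext (fun t => << Some t >>) x) u) y.
Proof.
rewrite /st_starL bilin_ext_lin_extUl; apply/esym/bilin_ext_assoc => t a b.
rewrite linearD /= lin_extU lin_extD; congr (_ + _).
by case: b => [[c s d]|]; rewrite ?lin_extU // linear0 lin_ext0.
Qed.

(** The contracted summand of [stree_join] when the right child is not a leaf. *)
Definition merge_right (k : fieldType) (a : stree) : ST k -> ST k :=
  lin_ext (fun u : stree1 => let: SNode c s d := u in << SNode a (c :: s) d >>).

(** Under [prec] and [bullet] the root of the left factor stays the root and just receives the extra
    child [a]. Under [succ] the whole left factor enters the first child of [t], and sharing the
    root of [t] with [a] is a [bullet] product. *)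
Lemma merge_right_star (k : fieldType) (a c : stree) (s : seq stree) (d : stree)
    (t : stree1) :
  merge_right a (st_star1 k (SNode c s d) t)
  = st_prec1 k (SNode a (c :: s) d) t
    + st_bullet1 k (SNode a [::] (Some (SNode c s d))) t
    + st_bullet1 k (SNode a (c :: s) d) t.
Proof.
have prec : merge_right a (st_prec1 k (SNode c s d) t)
    = st_prec1 k (SNode a (c :: s) d) t by apply: lin_ext_lin_extU.
have succ : merge_right a (st_succ1 k (SNode c s d) t)
    = st_bullet1 k (SNode a [::] (Some (SNode c s d))) t.
  by case: (t) => c' s' d'; apply: lin_ext_lin_extU.
have bullet : merge_right a (st_bullet1 k (SNode c s d) t)
    = st_bullet1 k (SNode a (c :: s) d) t.
  by case: (t) => c' s' d'; apply: lin_ext_lin_extU.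
by rewrite -prec -succ -bullet st_star1E /merge_right 2!linearD.
Qed.

(** On basis elements with a nontrivial right child the left side has four terms: [prec] and
    [bullet] of the kept and of the contracted tree. On the right, keeping the edge gives [prec] of
    the kept tree and [merge_right_star] supplies the other three; hence [prec] on binary trees must
    become [preceq]. *)
Lemma preceq_stree_join (k : fieldType) (u y : {malg k[stree]}) (z : ST k) :
  st_preceq (stree_join u y) z
  = stree_join u (st_starL y (lin_ext (fun t => << Some t >>) z)).
Proof.
rewrite st_preceqE /st_starL bilin_ext_lin_extUr.
apply: bilin_ext_assoc => a [v|] t; rewrite linearD; last first.
  (* The right child is a leaf: [prec] grafts [t] there, and [bullet] is the contraction of the new
     edge. *)
  rewrite linear0 addr0 [LHS]lin_extU [RHS]lin_extU.
  by case: t => c s d; congr (_ + _); apply: lin_extU.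
transitivity (lin_ext (fun u : stree1 => << SNode a [::] (Some u) >> +
   (let: SNode c s d := u in << SNode a (c :: s) d >>)) (st_star1 k v t));
  last by apply/esym/lin_ext_lin_extU.
case: v => c s d; rewrite lin_extD -[X in _ = _ + X]/(merge_right a _).
rewrite merge_right_star.
have -> : lin_ext (fun u => << SNode a [::] (Some u) >>) (st_star1 k (SNode c s d) t)
    = st_prec1 k (SNode a [::] (Some (SNode c s d))) t.
  by apply/esym/lin_ext_lin_extU.
transitivity (st_prec1 k (SNode a [::] (Some (SNode c s d))) t +
   st_bullet1 k (SNode a [::] (Some (SNode c s d))) t +
  (st_prec1 k (SNode a (c :: s) d) t + st_bullet1 k (SNode a (c :: s) d) t)).
  by congr (_ + _); apply: lin_extU.
have addrABC (V : zmodType) (p q r w : V) : p + q + (r + w) = p + (r + q + w).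
  by rewrite -!addrA (addrCA q).
exact: addrABC.
Qed.

Lemma psi_lin_PNode_right (k : fieldType) (a : ptree) (x : {malg k[ptree]}) :
  psi k (lin_ext (fun b => << PNode a b >>) x)
  = stree_join (psi0 k << a >>) (psi0 k x).
Proof.
elim/malg_ind: x => [|c x y IHx IHy|b].
- by rewrite !linear0 /stree_join bilin_ext0r.
- by rewrite !linearP IHx IHy /stree_join bilin_extPr.
- by rewrite lin_extU psi_PNode.
Qed.

Lemma psi_lin_PNode_left (k : fieldType) (b : ptree) (x : {malg k[ptree]}) :
  psi k (lin_ext (fun a => << PNode a b >>) x)
  = stree_join (psi0 k x) (psi0 k << b >>).
Proof.
elim/malg_ind: x => [|c x y IHx IHy|a].
- by rewrite !linear0 /stree_join bilin_ext0l.
- by rewrite !linearP IHx IHy /stree_join bilin_extPl.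
- by rewrite lin_extU psi_PNode.
Qed.

Lemma psi0U (k : fieldType) (t : ptree1) :
  psi0 k << Some t >> = lin_ext (fun u => << Some u >>) (psi k << t >>).
Proof. exact: lin_extU. Qed.

(** The compatibility with the star product on the smaller pair is a hypothesis, so that the lemma
    serves inside the induction of [psi0_star] as well as after it. *)
Lemma psi_prec1 (k : fieldType) (a b : ptree) (t : ptree1) :
  psi0 k (pbt_star k b (Some t)) = st_starL (psi0 k << b >>) (psi0 k << Some t >>) ->
  psi k (pbt_prec1 k (PNode a b) t)
  = st_preceq (psi k << PNode a b >>) (psi k << t >>).
Proof.
move=> starP; rewrite /pbt_prec1 psi_lin_PNode_right starP psi0U psi_PNode.
by rewrite preceq_stree_join.
Qed.

Lemma psi_succ1 (k : fieldType) (s : ptree1) (a b : ptree) :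
  psi0 k (pbt_star k (Some s) a) = st_starL (psi0 k << Some s >>) (psi0 k << a >>) ->
  psi k (pbt_succ1 k s (PNode a b))
  = st_succ (psi k << s >>) (psi k << PNode a b >>).
Proof.
move=> starP; rewrite /pbt_succ1 psi_lin_PNode_left starP psi0U psi_PNode.
by rewrite succ_stree_join.
Qed.

Lemma psi0_None (k : fieldType) : psi0 k << None >> = << None >>.
Proof. exact: lin_extU. Qed.

Lemma st_starL_Nonel (k : fieldType) (x : {malg k[stree]}) :
  st_starL << None >> x = x.
Proof.
rewrite /st_starL; elim/malg_ind: x => [|c x y IHx IHy|b].
- by rewrite bilin_ext0r.
- by rewrite bilin_extPr IHx IHy.
- by rewrite bilin_extUU.
Qed.

Lemma st_starL_Noner (k : fieldType) (x : {malg k[stree]}) :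
  st_starL x << None >> = x.
Proof.
rewrite /st_starL; elim/malg_ind: x => [|c x y IHx IHy|b].
- by rewrite bilin_ext0l.
- by rewrite bilin_extPl IHx IHy.
- by rewrite bilin_extUU; case: b.
Qed.

Lemma st_starL_psi0 (k : fieldType) (s t : ptree1) :
  st_starL (psi0 k << Some s >>) (psi0 k << Some t >>)
  = lin_ext (fun u => << Some u >>)
      (st_preceq (psi k << s >>) (psi k << t >>)
       + st_succ (psi k << s >>) (psi k << t >>)).
Proof.
exact: etrans (congr2 (@st_starL k) (psi0U k s) (psi0U k t)) (st_starL_Some _ _).
Qed.

Lemma psi0_star (k : fieldType) (a b : ptree) :
  psi0 k (pbt_star k a b) = st_starL (psi0 k << a >>) (psi0 k << b >>).
Proof.
case: a => [s|]; last by rewrite psi0_None st_starL_Nonel.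
case: b => [t|]; last by rewrite psi0_None st_starL_Noner.
(* Nested induction: [prec] calls the star product on the right child of [s] with the same [t],
   [succ] on the same [s] with the left child of [t]. *)
elim/ptree1_nested_ind: s t => a b _ IHb.
elim/ptree1_nested_ind=> c d IHc _.
rewrite st_starL_psi0.
rewrite -psi_prec1; last first.
  by case: (b) IHb => [s|_]; [apply | rewrite psi0_None st_starL_Nonel].
rewrite -psi_succ1; last first.
  by case: (c) IHc => [t|_]; [exact | rewrite psi0_None st_starL_Noner].
by rewrite -linearD -pbt_star1E; apply: psi0_Some.
Qed.

Lemma psi_prec (k : fieldType) (x y : PBT k) :
  psi k (pbt_prec x y) = st_preceq (psi k x) (psi k y).
Proof.
rewrite /pbt_prec /st_preceq /st_prec /st_bullet.
elim/malg_ind: x => [|c x x' IHx IHx'|s].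
- by rewrite !(linear0, bilin_ext0l, addr0).
- by rewrite linearP !bilin_extPl linearP IHx IHx' scalerDr addrACA.
elim/malg_ind: y => [|c y y' IHy IHy'|t].
- by rewrite !(linear0, bilin_ext0r, addr0).
- by rewrite linearP !bilin_extPr linearP IHy IHy' scalerDr addrACA.
by rewrite bilin_extUU; case: s => a b; apply: psi_prec1 (psi0_star _ _ _).
Qed.

Lemma psi_succ (k : fieldType) (x y : PBT k) :
  psi k (pbt_succ x y) = st_succ (psi k x) (psi k y).
Proof.
rewrite /pbt_succ /st_succ; elim/malg_ind: x => [|c x x' IHx IHx'|s].
- by rewrite !(linear0, bilin_ext0l).
- by rewrite linearP !bilin_extPl linearP IHx IHx'.
elim/malg_ind: y => [|c y y' IHy IHy'|t].
- by rewrite !(linear0, bilin_ext0r).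
- by rewrite linearP !bilin_extPr linearP IHy IHy'.
by rewrite bilin_extUU; case: t => a b; apply: psi_succ1 (psi0_star _ _ _).
Qed.

(** * Packed words and Cartesian trees *)

Local Open Scope nat_scope.

Lemma packed_gt0 (w : seq nat) a : packed w -> a \in w -> 0 < a.
Proof. by case/andP=> w0 _ aw; rewrite lt0n; apply: contraNneq w0 => <-. Qed.

Lemma packedP (w : seq nat) :
  reflect (0 \notin w /\ forall a b, a \in w -> 0 < b <= a -> b \in w) (packed w).
Proof.
apply: (iffP idP) => [pw|[w0 win]].
  split=> [|a b aw /andP[b_gt0 le_ba]]; first by case/andP: pw.
  case/andP: pw => _ /allP; apply; rewrite mem_iota b_gt0 add1n ltnS.
  by apply: leq_trans le_ba _; apply: (maxw_leq _ _ (leqnn _)).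
rewrite /packed w0; apply/allP=> b; rewrite mem_iota add1n ltnS => /andP[b_gt0].
move=> le_b; have [[a aw le_ba]|max_lt] := altP (@hasP _ (leq b) w).
  by apply: win aw _; rewrite b_gt0.
suff : maxw w < b by rewrite ltnNge le_b.
rewrite -(prednK b_gt0) ltnS; apply/maxw_leq=> a aw.
rewrite -ltnS prednK // ltnNge; apply: contra max_lt => le_ba.
by apply/hasP; exists a.
Qed.

Lemma mem1_packed (w : seq nat) : packed w -> w != [::] -> 1 \in w.
Proof.
case: w => // a w pw _; have [_ win] := packedP _ pw.
by apply: (win a); rewrite ?mem_head //= (packed_gt0 pw) ?mem_head.
Qed.

Lemma packed_id (w : seq nat) : packed w -> Pack w = w.
Proof.
move=> pw; apply: map_id_in => a aw /=.
have le_a : a <= maxw w by apply: (maxw_leq _ _ (leqnn _)).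
rewrite (permP (_ : perm_eq _ (iota 1 (maxw w)))); last first.
  apply: uniq_perm (undup_uniq _) (iota_uniq _ _) _; exact: undup_letters.
rewrite -(subnKC le_a) iotaD count_cat.
rewrite (eq_in_count (a2 := predT)) ?count_predT ?size_iota; last first.
  by move=> b; rewrite mem_iota => /andP[_]; rewrite add1n ltnS => ->.
rewrite (eq_in_count (a2 := pred0)) ?count_pred0 ?addn0 // => b.
by rewrite mem_iota add1n => /andP[lt_b _]; apply: ltn_geF.
Qed.

Lemma Pack_addn c (w : seq nat) : Pack [seq c + a | a <- w] = Pack w.
Proof.
rewrite /Pack undup_map_inj; last exact: addnI.
rewrite -map_comp; apply: eq_map => a /=; rewrite count_map.
by apply: eq_count => b /=; rewrite leq_add2l.
Qed.

(* [order_similar z]: the words unzip1 z and unzip2 z have the same relative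
   order, equal letters being ranked from left to right. *)
Definition order_similar : seq (nat * nat) -> bool :=
  pairwise (fun p q => (p.1 <= q.1) == (p.2 <= q.2)).

(* The binary tree of a word: the root is the leftmost minimal letter. *)
Inductive cartesian : seq nat -> ptree -> Prop :=
| CartesianNil : cartesian [::] None
| CartesianNode u m v a b of all (ltn m) u & all (leq m) v
    & cartesian u a & cartesian v b :
    cartesian (u ++ m :: v) (Some (PNode a b)).

Lemma unzip1_cat_inv (z : seq (nat * nat)) u m v :
  unzip1 z = u ++ m :: v ->
  exists z1 n z2, [/\ z = z1 ++ (m, n) :: z2, unzip1 z1 = u & unzip1 z2 = v].
Proof.
move=> zE; exists (take (size u) z).
move: (congr1 (take (size u)) zE) (congr1 (drop (size u)) zE).
rewrite -map_take -map_drop take_size_cat // drop_size_cat // => uE.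
case E : (drop (size u) z) => [|[m' n] z2] //= [<- <-].
by exists n, z2; split=> //; rewrite -E cat_take_drop.
Qed.

(** The clauses of [cartesian] compare the root letter with letters on a fixed side of it, the
    strict one being the negation of a [<=], so they depend only on what [order_similar]
    preserves. *)
Lemma cartesian_similar z t :
  order_similar z -> cartesian (unzip1 z) t -> cartesian (unzip2 z) t.
Proof.
move=> zsim; move zE: (unzip1 z) => w c.
elim: c z zE zsim => [|u m v a b um vm _ IHu _ IHv] z.
  by case: z => // _ _; apply: CartesianNil.
case/unzip1_cat_inv=> z1 [n [z2 [-> Eu Ev]]] zsim.
move: zsim; rewrite /order_similar pairwise_cat pairwise_cons allrel_consr.
case/and3P=> /andP[z1n _] z1sim /andP[nz2 z2sim].
rewrite /unzip2 map_cat /=; apply: CartesianNode.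
- rewrite all_map; apply/allP=> p pz1; have /eqP/= E := allP z1n p pz1.
  by rewrite /= ltnNge -E -ltnNge; apply: (allP um); rewrite -Eu map_f.
- rewrite all_map; apply/allP=> p pz2; have /eqP/= <- := allP nz2 p pz2.
  by apply: (allP vm); rewrite -Ev map_f.
- exact: IHu.
- exact: IHv.
Qed.

(** Both root letters are the minimum of the word, at its first occurrence, so the two
    decompositions coincide. *)
Lemma cartesian_inj w t t' : cartesian w t -> cartesian w t' -> t = t'.
Proof.
move=> c; elim: c t' => [|u m v a b um vm _ IHu _ IHv] t' c'.
  inversion c' => //; last by case: (u) H.
inversion c' as [E|u' m' v' a' b' um' vm' cu' cv' E].
  by case: (u) E.
have mu : m \notin u by apply/negP=> /(allP um) /=; rewrite ltnn.
have mu' : m' \notin u' by apply/negP=> /(allP um') /=; rewrite ltnn.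
have mE : m = m'.
  apply/eqP; rewrite eqn_leq; apply/andP; split.
    have : m' \in u ++ m :: v by rewrite -E mem_cat mem_head orbT.
    by rewrite mem_cat inE => /or3P[/(allP um)/ltnW|/eqP->|/(allP vm)].
  have : m \in u' ++ m' :: v' by rewrite E mem_cat mem_head orbT.
  by rewrite mem_cat inE => /or3P[/(allP um')/ltnW|/eqP->|/(allP vm')].
move: E mu'; rewrite -mE => E mu'; have sz : size u' = size u.
  have := congr1 (index m) E; rewrite !index_cat.
  by rewrite (negPf mu) (negPf mu') /= eqxx !addn0.
move/eqP: E; rewrite eqseq_cat // => /andP[/eqP Eu /eqP[Ev]].
by rewrite (IHu a') -?Eu // (IHv b') -?Ev.
Qed.

Definition Pack_letter (w : seq nat) (a : nat) : nat :=
  count (fun b => b <= a) (undup w).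

Lemma Pack_letter_mono (w : seq nat) : {in w &, {mono Pack_letter w : a b / a <= b}}.
Proof.
have mono a b : a <= b -> Pack_letter w a <= Pack_letter w b.
  by move=> le_ab; apply: sub_count => c /= /leq_trans->.
move=> a b aw bw; apply/idP/idP => [|/mono//]; apply: contraLR.
(* The extra unit is the letter [a] itself, counted in [Pack_letter w a] but not among the letters
   below [a]. *)
rewrite -!ltnNge => lt_ba; apply: (@leq_trans (count (fun c => c < a) (undup w)).+1).
  by rewrite ltnS; apply: sub_count => c /= /leq_ltn_trans->.
rewrite -addn1 -[1]/(nat_of_bool true) -aw -mem_undup -count_uniq_mem ?undup_uniq //.
rewrite -count_predUI [X in _ + X](eq_count (a2 := pred0)) ?count_pred0 ?addn0.
  by apply: sub_count => c /= /orP[/ltnW|/eqP->].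
by move=> c /=; case: ltngtP.
Qed.

Lemma Pack_uniq (w : seq nat) : uniq w -> uniq (Pack w).
Proof.
move=> w_uniq; rewrite map_inj_in_uniq // => a b aw bw.
rewrite -[count _ _]/(Pack_letter w a) -[RHS]/(Pack_letter w b) => /eqP.
by rewrite eqn_leq !Pack_letter_mono // -eqn_leq => /eqP.
Qed.

Lemma cartesian_Pack w t : cartesian (Pack w) t -> cartesian w t.
Proof.
pose z := [seq (Pack_letter w a, a) | a <- w].
suff : cartesian (unzip1 z) t -> cartesian (unzip2 z) t.
  by rewrite /unzip1 /unzip2 -!map_comp [X in _ -> cartesian X _]map_id.
apply: cartesian_similar; rewrite /order_similar pairwise_map.
apply/(pairwiseP 0) => i j iw jw _ /=; apply/eqP; apply: Pack_letter_mono;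
  exact: mem_nth.
Qed.

Lemma split_ones_cat (u v : seq nat) :
  1 \notin u -> split_ones (u ++ 1 :: v) = u :: split_ones v.
Proof.
elim: u => //= a u IH; rewrite inE negb_or eq_sym => /andP[/negPf-> /IH->].
by [].
Qed.

Lemma split_first_one (w : seq nat) :
  1 \in w -> exists u v, w = u ++ 1 :: v /\ 1 \notin u.
Proof.
case/splitPr=> p1 p2; elim: p1 => [|a p1 [u [v [E u1]]]]; first by exists [::], p2.
have [->|a1] := eqVneq a 1; first by exists [::], (p1 ++ 1 :: p2).
by exists (a :: u), v; rewrite cat_cons E inE negb_or eq_sym a1.
Qed.

(** Unlike [graft], meaningful on a single tree, which it binarizes; this is the base of the
    recursion along the occurrences of 1. *)
Definition binarize_graft (ts : seq stree) : ptree :=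
  foldr (fun x y => Some (PNode (binarize x) y)) (binarize (last None ts))
        (take (size ts).-1 ts).

Lemma binarize_graftE t ts : ts != [::] ->
  binarize_graft (t :: ts) = Some (PNode (binarize t) (binarize_graft ts)).
Proof. by case: ts. Qed.

Lemma binarize_graftP t ts : ts != [::] ->
  binarize (graft (t :: ts)) = binarize_graft (t :: ts).
Proof.
case: ts => // x s _; rewrite /binarize_graft /=.
congr (Some (PNode _ _)); elim: s x => //= y s IH x.
by rewrite -(IH y) /=; case: s {IH}.
Qed.

(** Stated without packedness because the suffix after the first 1 need be neither packed nor
    contain a 1. *)
Lemma cartesian_split_ones (w : seq nat) : 0 \notin w ->
  cartesian w (binarize_graft [seq rho (Pack u) | u <- split_ones w]).
Proof.
have [n] := ubnP (size w); elim: n w => // n IHn w; rewrite ltnS => le_w w0.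
(* Isolated because a word without 1 is handled through its packing, which contains a 1 but has the
   same length, out of reach of the induction hypothesis. *)
have case1 (w' : seq nat) : size w' <= n -> 0 \notin w' -> 1 \in w' ->
    cartesian w' (binarize_graft [seq rho (Pack u) | u <- split_ones w']).
  move=> le_w' w'0 /split_first_one[u [v [E u1]]]; move: le_w' w'0; rewrite E size_cat /=.
  rewrite mem_cat inE /= negb_or => le_uv /andP[u0 v0].
  rewrite split_ones_cat //= binarize_graftE; last first.
    by rewrite -size_eq0 size_map size_split_ones.
  apply: CartesianNode.
  - apply/allP=> a au /=; have : a != 0 by apply: contraNneq u0 => <-.
    have : a != 1 by apply: contraNneq u1 => <-.
    by case: (a) => [|[]].
  - by apply/allP=> a av /=; rewrite lt0n; apply: contraNneq v0 => <-.
  - have := IHn u; rewrite split_ones_notin //; apply=> //. lia.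
  - apply: IHn => //; lia.
have [w1|w1] := boolP (1 \in w); first exact: case1.
rewrite split_ones_notin // [binarize_graft _]/(binarize (rho (Pack w))).
have [->|w_n0] := eqVneq w [::]; first exact: CartesianNil.
have pw := packed_Pack w; apply: cartesian_Pack.
have Pw_n0 : Pack w != [::] by rewrite -size_eq0 size_Pack size_eq0.
have Pw1 := mem1_packed pw Pw_n0.
rewrite -/(binarize _) rhoE //.
have := case1 _ _ _ Pw1; rewrite size_Pack => /(_ le_w).
have [-> _] := packedP _ pw => /(_ isT).
have [u [v [-> u1]]] := split_first_one Pw1.
rewrite split_ones_cat // map_cons binarize_graftP //.
by rewrite -size_eq0 size_map size_split_ones.
Qed.

Lemma cartesian_rho (w : seq nat) : packed w -> cartesian w (binarize (rho w)).
Proof.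
move=> pw; have [->|w_n0] := eqVneq w [::]; first exact: CartesianNil.
have [w0 _] := packedP _ pw.
have := cartesian_split_ones w0; rewrite rhoE //.
have [u [v [-> u1]]] := split_first_one (mem1_packed pw w_n0).
rewrite split_ones_cat // map_cons binarize_graftP //.
by rewrite -size_eq0 size_map size_split_ones.
Qed.

(** With distinct letters the 1 occurs once, so every vertex has exactly two children. *)
Lemma rho_uniq (w : seq nat) : packed w -> uniq w ->
  rho w = omap schroeder1 (binarize (rho w)).
Proof.
have [n] := ubnP (size w); elim: n w => // n IHn w; rewrite ltnS => le_w pw w_uniq.
have [->//|w_n0] := eqVneq w [::].
rewrite rhoE //; have [u [v [E u1]]] := split_first_one (mem1_packed pw w_n0).
move: w_uniq le_w; rewrite E split_ones_cat // cat_uniq /= size_cat /=.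
case/and4P=> uu _ v1 vu le_w; rewrite split_ones_notin //= .
by rewrite -!IHn ?packed_Pack ?size_Pack ?Pack_uniq //; lia.
Qed.

(** * Standardization, shuffles and coproducts *)

Lemma permw_packed (w : seq nat) : packed w -> uniq w -> permw w.
Proof.
move=> pw uw.
have wE : perm_eq w (iota 1 (maxw w)).
  by apply: uniq_perm (iota_uniq _ _) _ => // a; rewrite -undup_letters ?mem_undup.
by rewrite /permw (perm_size wE) size_iota.
Qed.

Lemma permw_uniq (w : seq nat) : permw w -> uniq w.
Proof. by move/perm_uniq->; apply: iota_uniq. Qed.

(* Adding the position to a large multiple of each letter makes the letters
   distinct and breaks ties from left to right. *)
Fixpoint distinct_letters (n i : nat) (w : seq nat) : seq (nat * nat) :=
  if w is a :: w' then (a, a * n + i) :: distinct_letters n i.+1 w' else [::].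

Lemma distinct_lettersP (n i : nat) (w : seq nat) : i + size w <= n ->
  [/\ unzip1 (distinct_letters n i w) = w,
      order_similar (distinct_letters n i w) &
      uniq (unzip2 (distinct_letters n i w))].
Proof.
(* Positions stay below [n], so [a * n + l] orders the pairs of a letter and a position
   lexicographically. *)
have memP p j v : j + size v <= n -> p \in distinct_letters n j v ->
    exists2 l, j <= l < n & p.2 = p.1 * n + l.
  elim: v j => //= a v IH j; rewrite -addSnnS inE => le_jn /orP[/eqP->|].
    by exists j => //=; lia.
  by case/(IH _ le_jn)=> l lP pE; exists l => //; lia.
elim: w i => //= a w IH i; rewrite -addSnnS => le_in.
have [-> zsim zuniq] := IH _ le_in; split=> //.
  rewrite /order_similar /= -/(order_similar _) zsim andbT; apply/allP=> -[b c].
  case/(memP _ _ _ le_in) => l /= lP ->.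
  by apply/eqP; case: (leqP a b) => le_ab; nia.
rewrite zuniq andbT; apply/mapP=> -[[b c]] /(memP _ _ _ le_in)[l /= lP ->].
by move=> E; have [?|?|?] := ltngtP a b; nia.
Qed.

Lemma exists_standardization (w : seq nat) : exists z,
  [/\ unzip1 z = w, order_similar z, packed (unzip2 z) & permw (unzip2 z)].
Proof.
have [wE] := @distinct_lettersP (size w) 0 w (leqnn _).
set z := distinct_letters _ _ _ in wE * => zsim zuniq.
exists [seq (p.1, Pack_letter (unzip2 z) p.2) | p <- z].
have E2 : unzip2 [seq (p.1, Pack_letter (unzip2 z) p.2) | p <- z] = Pack (unzip2 z).
  by rewrite /unzip2 /Pack -!map_comp.
split; first by rewrite -[RHS]wE /unzip1 -map_comp.
- rewrite /order_similar pairwise_map.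
  apply/(pairwiseP (0, 0)) => i j iz jz lt_ij /=.
  have /eqP-> := pairwiseP (0, 0) zsim i j iz jz lt_ij.
  by rewrite Pack_letter_mono // map_f // mem_nth.
- by rewrite E2 packed_Pack.
- by rewrite E2 permw_packed ?packed_Pack ?Pack_uniq.
Qed.

(** * Shuffles of words, and cutting a word at a letter value *)

Fixpoint shuffle (T : Type) (m : bitseq) (s t : seq T) : seq T :=
  match m, s, t with
  | true :: m', x :: s', _ => x :: shuffle m' s' t
  | false :: m', _, y :: t' => y :: shuffle m' s t'
  | _, _, _ => [::]
  end.

Lemma map_shuffle (T U : Type) (f : T -> U) m (s t : seq T) :
  map f (shuffle m s t) = shuffle m (map f s) (map f t).
Proof. by elim: m s t => [|[] m IH] [|x s] [|y t] //=; rewrite IH. Qed.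

Lemma mem_shuffle (T : eqType) m (s t : seq T) :
  {subset shuffle m s t <= s ++ t}.
Proof.
elim: m s t => [|[] m IH] s t z //=; [case: s => // x s | case: t => // y t];
  rewrite !(inE, mem_cat) => /orP[->|/IH]; rewrite ?orbT //.
  by rewrite mem_cat => /orP[]->; rewrite ?orbT.
by rewrite mem_cat => /orP[]->; rewrite ?orbT.
Qed.

Lemma pairwise_shuffle (T : eqType) (r : rel T) m (s t : seq T) :
  pairwise r s -> pairwise r t ->
  {in s & t, forall x y, r x y && r y x} -> pairwise r (shuffle m s t).
Proof.
elim: m s t => [|[] m IH] s t //=; [case: s => //= x s | case: t => //= y t].
  case/andP=> xs ss tt st; rewrite IH // ?andbT; last first.
    by move=> a b as_ bt; apply: st; rewrite // inE as_ orbT.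
  apply/allP=> z /mem_shuffle; rewrite mem_cat => /orP[/(allP xs)//|zt].
  by have /andP[] := st _ _ (mem_head _ _) zt.
move=> ss /andP[yt tt] st; rewrite IH // ?andbT; last first.
  by move=> a b as_ bt; apply: st; rewrite // inE bt orbT.
apply/allP=> z /mem_shuffle; rewrite mem_cat => /orP[zs|/(allP yt)//].
by have /andP[] := st _ _ zs (mem_head _ _).
Qed.

Definition shuffle_masks (p q : nat) : seq bitseq :=
  [seq m <- [seq val m | m : (p + q).-tuple bool] | count id m == p].

Lemma mem_shuffle_masks p q m :
  (m \in shuffle_masks p q) = (count id m == p) && (count negb m == q).
Proof.
rewrite mem_filter; have [cm|//] := eqVneq (count id m) p.
have szm : size m = p + count negb m by rewrite -cm -(count_predC id).
rewrite -(eqn_add2l p) -szm /=; apply/imageP/idP => [[u _ ->]|szmE].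
  by rewrite size_tuple.
by exists (Tuple szmE).
Qed.

Lemma shuffle_masks_uniq p q : uniq (shuffle_masks p q).
Proof. by rewrite filter_uniq // map_inj_uniq ?enum_uniq //; apply: val_inj. Qed.

Lemma perm_shuffle (T : eqType) m (s t : seq T) :
  m \in shuffle_masks (size s) (size t) -> perm_eq (shuffle m s t) (s ++ t).
Proof.
rewrite mem_shuffle_masks; elim: m s t => [|[] m IH] s t /=.
- by case: s; case: t.
- by case: s => [|x s] //=; rewrite add1n add0n eqSS perm_cons; apply: IH.
- case: t => [|y t] /=; first by rewrite andbF.
  rewrite add1n add0n eqSS -[s ++ _]/(s ++ [:: y] ++ t) perm_sym perm_catCA /=.
  by rewrite perm_cons perm_sym; apply: IH.
Qed.

Lemma shuffle_separated (T : eqType) (a : pred T) m (s t : seq T) :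
  m \in shuffle_masks (size s) (size t) -> all a s -> all (predC a) t ->
  [/\ map a (shuffle m s t) = m, filter a (shuffle m s t) = s
    & filter (predC a) (shuffle m s t) = t].
Proof.
rewrite mem_shuffle_masks; elim: m s t => [|[] m IH] s t /=.
- by case: s; case: t.
- case: s => [|x s] //=; rewrite add1n add0n eqSS => mP /andP[-> as_] at_.
  by have [-> -> ->] := IH _ _ mP as_ at_.
- case: t => [|y t] /=; first by rewrite andbF.
  rewrite add1n add0n eqSS => mP as_ /andP[/[dup]ay /negPf-> at_].
  by have [-> -> ->] := IH _ _ mP as_ at_.
Qed.

Lemma shuffle_filter (T : eqType) (a : pred T) (w : seq T) :
  shuffle (map a w) (filter a w) (filter (predC a) w) = w.
Proof. by elim: w => //= x w IH; case: (a x) => /=; rewrite IH. Qed.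

(** A term of the shifted shuffle product, dual to cutting a word at a letter value. *)
Definition shifted_shuffle (m : bitseq) (u v : seq nat) : seq nat :=
  shuffle m u [seq maxw u + b | b <- v].

Lemma packed_shifted_shuffle m (u v : seq nat) :
  m \in shuffle_masks (size u) (size v) -> packed u -> packed v ->
  packed (shifted_shuffle m u v).
Proof.
move=> mP pu pv; have [[u0 uP] [v0 vP]] := (packedP _ pu, packedP _ pv).
have memE b : (b \in shifted_shuffle m u v) =
    (b \in u) || (b \in [seq maxw u + b | b <- v]).
  by rewrite (perm_mem (perm_shuffle _)) ?mem_cat ?size_map.
apply/packedP; split.
  rewrite memE negb_or u0; apply/mapP=> -[b bv /esym/eqP].
  by rewrite addn_eq0 => /andP[_ /eqP b0]; rewrite -b0 bv in v0.
move=> a b; rewrite !memE => /orP[au /andP[b_gt0 le_ba]|/mapP[c cv ->]].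
  by rewrite (uP _ _ au) ?b_gt0.
case/andP=> b_gt0 le_b; have [le_bM|lt_Mb] := leqP b (maxw u).
  have [u_nil|u_n0] := eqVneq u [::].
    by move: le_bM; rewrite u_nil /maxw big_nil leqNgt b_gt0.
  by rewrite (uP _ _ (maxw_in pu u_n0)) ?b_gt0.
apply/orP; right; apply/mapP; exists (b - maxw u); last by rewrite subnKC // ltnW.
by apply: (vP _ _ cv); rewrite subn_gt0 lt_Mb leq_subLR.
Qed.

(** The two shifts may differ, yet in both coordinates every letter of the first word lies strictly
    below every shifted letter of the second, since packed words have positive letters. *)
Lemma shifted_shuffle_similar m (z1 z2 : seq (nat * nat)) :
  packed (unzip1 z2) -> packed (unzip2 z2) ->
  order_similar z1 -> order_similar z2 ->
  exists2 z, order_similar z &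
    unzip1 z = shifted_shuffle m (unzip1 z1) (unzip1 z2) /\
    unzip2 z = shifted_shuffle m (unzip2 z1) (unzip2 z2).
Proof.
move=> p1 p2 sim1 sim2; set M1 := maxw (unzip1 z1); set M2 := maxw (unzip2 z1).
exists (shuffle m z1 [seq (M1 + p.1, M2 + p.2) | p <- z2]); last first.
  by rewrite /unzip1 /unzip2 /shifted_shuffle !map_shuffle -!map_comp.
apply: pairwise_shuffle => //.
  rewrite pairwise_map; apply: sub_pairwise sim2 => p q /=.
  by rewrite !leq_add2l.
move=> p _ pz1 /mapP[q qz2 ->] /=.
have le1 : p.1 <= M1 by apply: (maxw_leq _ _ (leqnn _)); apply: map_f.
have le2 : p.2 <= M2 by apply: (maxw_leq _ _ (leqnn _)); apply: map_f.
have gt1 : 0 < q.1 by apply: packed_gt0 p1 _; apply: map_f.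
have gt2 : 0 < q.2 by apply: packed_gt0 p2 _; apply: map_f.
have aux (a b c d : nat) : a <= M1 -> b <= M2 -> 0 < c -> 0 < d ->
    ((a <= M1 + c) == (b <= M2 + d)) && ((M1 + c <= a) == (M2 + d <= b)).
  by move=> *; apply/andP; split; apply/eqP; lia.
exact: aux.
Qed.

Definition pshuffle (m : bitseq) (w1 w2 : pword) : pword :=
  insubd w1 (shifted_shuffle m w1 w2).

Lemma pword_packed (w : pword) : packed w.
Proof. by case/andP: (pwordP w). Qed.

Lemma pword_neq0 (w : pword) : val w != [::].
Proof. by case/andP: (pwordP w). Qed.

Lemma val_pshuffle m (w1 w2 : pword) :
  m \in shuffle_masks (size w1) (size w2) ->
  val (pshuffle m w1 w2) = shifted_shuffle m w1 w2.
Proof.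
move=> mP; rewrite /pshuffle insubdK // -topredE /=.
rewrite packed_shifted_shuffle ?pword_packed //=.
rewrite -size_eq0 (perm_size (perm_shuffle _)) ?size_map // size_cat addn_eq0.
by rewrite size_eq0 negb_and pword_neq0.
Qed.

Lemma shifted_shuffleP m (u v : seq nat) (M := maxw u) :
  packed v -> m \in shuffle_masks (size u) (size v) ->
  let w := shifted_shuffle m u v in
  [/\ [seq a <= M | a <- w] = m, [seq a <- w | a <= M] = u
    & [seq a <- w | M < a] = [seq M + b | b <- v]].
Proof.
move=> pv mP.
have [|||E1 E2 E3] :=
  @shuffle_separated _ (leq^~ M) m u [seq M + b | b <- v].
- by rewrite size_map.
- by apply/allP=> a; apply/maxw_leq.
- apply/allP=> _ /mapP[b bv ->] /=; rewrite -ltnNge -[X in X < _]addn0 ltn_add2l.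
  exact: packed_gt0 bv.
by split=> //; rewrite -[RHS]E3; apply: eq_filter => a /=; rewrite ltnNge.
Qed.

(** The letters above [M] of a packed word form an interval starting at [M + 1], if there are any,
    so packing them subtracts [M]. *)
Lemma addn_Pack_filter (w : seq nat) M : packed w ->
  [seq M + b | b <- Pack [seq a <- w | M < a]] = [seq a <- w | M < a].
Proof.
move=> pw; set g := filter _ w; pose h := [seq a - M | a <- g].
have gE : [seq M + b | b <- h] = g.
  rewrite -map_comp map_id_in // => a; rewrite mem_filter => /andP[lt_Ma _] /=.
  by rewrite subnKC // ltnW.
have [w0 wP] := packedP _ pw.
suff ph : packed h by rewrite -{1}gE Pack_addn packed_id.
apply/packedP; split.
  apply/mapP=> -[a]; rewrite mem_filter => /andP[lt_Ma _] /eqP.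
  by rewrite eq_sym subn_eq0 leqNgt lt_Ma.
move=> a b /mapP[c]; rewrite mem_filter => /andP[lt_Mc cw] -> /andP[b_gt0 le_b].
apply/mapP; exists (M + b); last by rewrite addKn.
rewrite mem_filter -[X in X < _]addn0 ltn_add2l b_gt0 /=; apply: wP cw _.
by rewrite addn_gt0 b_gt0 orbT /= -leq_subRL // ltnW.
Qed.

Lemma pword_max_gt0 (w : pword) : 0 < maxw w.
Proof.
have pw := pword_packed w.
exact: packed_gt0 pw (maxw_in pw (pword_neq0 w)).
Qed.

Lemma maxw_restrict (w : pword) i : 0 < i < maxw w -> maxw (restrict w i) = i.
Proof.
case/andP=> i_gt0 lt_i; rewrite -[pword_val _]/(val _) restrictE //.
apply/eqP; rewrite eqn_leq; apply/andP; split.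
  by apply/maxw_leq=> a; rewrite mem_filter => /andP[].
apply: (maxw_leq _ _ (leqnn _)); rewrite mem_filter leqnn /=.
have [_ wP] := packedP _ (pword_packed w).
by apply: (wP _ _ (maxw_in (pword_packed w) (pword_neq0 w))); rewrite i_gt0 ltnW.
Qed.

(** Cutting inverts shuffling: the height of the cut must be the maximum of [w1], and the mask
    records which letters lie below it. *)
Lemma cut_shuffle (w w1 w2 : pword) (M := maxw w1) (m := [seq a <= M | a <- val w]) :
  [&& 0 < M < maxw w, restrict w M == w1 & pack_rest w M == w2]
  = (m \in shuffle_masks (size w1) (size w2)) && (pshuffle m w1 w2 == w).
Proof.
apply/and3P/andP=> [[/andP[M_gt0 lt_M] /eqP E1 /eqP E2]|[mP /eqP wE]].
  have {}E1 : [seq a <- val w | a <= M] = w1 by rewrite -restrictE // E1.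
  have {}E2 : [seq a <- val w | M < a] = [seq M + b | b <- val w2].
    by rewrite -E2 pack_restE // addn_Pack_filter ?pword_packed.
  have mP : m \in shuffle_masks (size w1) (size w2).
    rewrite mem_shuffle_masks !count_map -E1 -(size_map (addn M) (val w2)) -E2.
    rewrite !size_filter eqxx /=; apply/eqP/eq_count => a /=.
    by rewrite ltnNge.
  split=> //; apply/eqP/val_inj; rewrite val_pshuffle // /shifted_shuffle.
  rewrite -[in shuffle _ w1]E1 -E2 -[RHS](@shuffle_filter _ (leq^~ M)).
  congr shuffle.
  by apply: eq_filter => a /=; rewrite ltnNge.
have vE : val w = shifted_shuffle m w1 w2 by rewrite -wE val_pshuffle.
have [_ E1 E2] := shifted_shuffleP (pword_packed w2) mP.
have lt_M : M < maxw w.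
  have b_in := maxw_in (pword_packed w2) (pword_neq0 w2).
  have : M + maxw w2 \in [seq a <- val w | M < a] by rewrite vE E2 map_f.
  rewrite mem_filter => /andP[lt_M aw]; apply: leq_trans lt_M _.
  exact: (maxw_leq _ _ (leqnn _)).
split; first by rewrite pword_max_gt0.
  by apply/eqP/val_inj; rewrite restrictE ?pword_max_gt0 // vE.
apply/eqP/val_inj; rewrite pack_restE // vE E2 Pack_addn packed_id //.
exact: pword_packed.
Qed.

Lemma binarize_rho_similar (z : seq (nat * nat)) :
  order_similar z -> packed (unzip1 z) -> packed (unzip2 z) ->
  binarize (rho (unzip1 z)) = binarize (rho (unzip2 z)).
Proof.
move=> zsim p1 p2; apply: cartesian_inj (cartesian_rho p2).
exact: cartesian_similar zsim (cartesian_rho p1).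
Qed.

(** The witnesses are standardizations of [w1] and [w2]. They move coefficients from arbitrary
    packed words to permutations, where [Omega_perm] lives, for all shuffles at once. *)
Lemma exists_permutation_pword (w1 w2 : pword) : exists s1 s2 : pword,
  [/\ size s1 = size w1, size s2 = size w2, permw s1, permw s2 &
   forall m, m \in shuffle_masks (size w1) (size w2) ->
     permw (pshuffle m s1 s2) /\
     binarize (rho (pshuffle m s1 s2)) = binarize (rho (pshuffle m w1 w2))]
  /\ binarize (rho s1) = binarize (rho w1)
  /\ binarize (rho s2) = binarize (rho w2).
Proof.
have [z1 [E1 sim1 pk1 pm1]] := exists_standardization w1.
have [z2 [E2 sim2 pk2 pm2]] := exists_standardization w2.
have sz1 : size (unzip2 z1) = size w1 by rewrite -E1 !size_map.
have sz2 : size (unzip2 z2) = size w2 by rewrite -E2 !size_map.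
have s1P : packed (unzip2 z1) && (unzip2 z1 != [::]).
  by rewrite pk1 -size_eq0 sz1 size_eq0 pword_neq0.
have s2P : packed (unzip2 z2) && (unzip2 z2 != [::]).
  by rewrite pk2 -size_eq0 sz2 size_eq0 pword_neq0.
exists (PWord s1P), (PWord s2P).
have [pw1 pw2] := (pword_packed w1, pword_packed w2).
split; last by split; [rewrite -E1|rewrite -E2];
  rewrite binarize_rho_similar ?E1 ?E2.
split=> // m mP.
have mP' : m \in shuffle_masks (size (unzip2 z1)) (size (unzip2 z2)).
  by rewrite sz1 sz2.
have vs : val (pshuffle m (PWord s1P) (PWord s2P))
    = shifted_shuffle m (unzip2 z1) (unzip2 z2) by apply: val_pshuffle.
split.
  apply: permw_packed (pword_packed _) _; rewrite -[pword_val _]/(val _) vs.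
  rewrite (perm_uniq (perm_shuffle _)) ?(size_map (addn _)) //.
  rewrite cat_uniq permw_uniq //=.
  rewrite map_inj_uniq ?permw_uniq //; last exact: addnI.
  rewrite andbT; apply/hasPn=> _ /mapP[b b2 ->]; apply/negP=> bM.
  have := maxw_leq _ _ (leqnn _) _ bM; rewrite -[X in _ <= X]addn0 leq_add2l.
  by rewrite leqNgt (packed_gt0 pk2).
rewrite -!/(val (pshuffle _ _ _)) vs val_pshuffle //.
have [|z zsim [Ez1 Ez2]] := @shifted_shuffle_similar m z1 z2 _ pk2 sim1 sim2.
  by rewrite E2.
rewrite -Ez2 -[in RHS]E1 -[in RHS]E2 -Ez1; apply/esym/binarize_rho_similar => //.
  by rewrite Ez1 packed_shifted_shuffle ?E1 ?E2.
by rewrite Ez2 packed_shifted_shuffle.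
Qed.

(** * Surjectivity of [rho] onto Schröder trees *)

(** Raising the blocks by 1 frees the letter 1 to separate them; packing the blocks undoes the
    shift. *)
Fixpoint join_ones (u : seq nat) (ws : seq (seq nat)) : seq nat :=
  [seq 1 + a | a <- u] ++ (if ws is v :: ws' then 1 :: join_ones v ws' else [::]).

Lemma split_join_ones u ws : all packed (u :: ws) ->
  split_ones (join_ones u ws) = [seq [seq 1 + a | a <- v] | v <- u :: ws].
Proof.
have S1 v : packed v -> 1 \notin [seq 1 + a | a <- v].
  move=> pv; apply/mapP=> -[a /(packed_gt0 pv)]; rewrite -{2}[1]addn0 => + /addnI.
  by case: a.
elim: ws u => [|v ws IH] u /=; first by rewrite cats0 andbT => /S1/split_ones_notin.
by case/andP=> /S1 u1 /IH IHv; rewrite split_ones_cat // IHv.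
Qed.

Lemma join_ones_packed u v ws : all packed [:: u, v & ws] ->
  packed (join_ones u (v :: ws)).
Proof.
have memE a us : (a \in flatten [seq 1 :: [seq 1 + b | b <- x] | x <- us]) =
    (us != [::]) && ((a == 1) || has (fun x => (0 < a) && (a.-1 \in x)) us).
  elim: us => //= x us IH; rewrite inE mem_cat IH.
  have -> : (a \in [seq 1 + b | b <- x]) = (0 < a) && (a.-1 \in x).
    case: a {IH} => [|a]; first by apply/mapP=> -[].
    by rewrite (mem_map (@addnI 1)).
  by case: (us) => [|y ys] /=; case: (a == 1); case: (_ && _).
(* A further leading 1 makes all blocks alike and leaves the set of letters unchanged, as a
   separator 1 is already present. *)
have joinE x us : 1 :: join_ones x us =
    flatten [seq 1 :: [seq 1 + b | b <- y] | y <- x :: us].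
  by elim: us x => [|y us IH] x //=; congr (_ :: _ ++ _); rewrite IH.
move=> /allP pks.
have jE a : (a \in join_ones u (v :: ws)) =
    (a == 1) || has (fun x => (0 < a) && (a.-1 \in x)) [:: u, v & ws].
  transitivity (a \in 1 :: join_ones u (v :: ws)); last by rewrite joinE memE.
  rewrite inE; case: eqP => // ->; rewrite /= mem_cat inE eqxx orbT.
  by [].
apply/packedP; split; first by rewrite jE; apply/hasP=> -[].
move=> a b; rewrite !jE => /orP[/eqP->|/hasP[x xs /andP[a_gt0 ax]]].
  by case: b => [|[]].
case: b => [|[|b]] // /andP[_ le_ba]; apply/orP; right; apply/hasP; exists x => //=.
have [_ xP] := packedP _ (pks _ xs); apply: (xP _ _ ax); lia.
Qed.

Lemma packed_nil : packed [::].
Proof. by rewrite /packed /maxw big_nil. Qed.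

Lemma rho_surj (t : stree) : exists2 w, packed w & rho w = t.
Proof.
case: t => [t|]; last by exists [::]; rewrite ?packed_nil.
elim/stree1_nested_ind: t => a s b Ha Hs Hb.
have opt (x : stree) :
    (if x is Some t then exists2 w, packed w & rho w = Some t else True) ->
    exists2 w, packed w & rho w = x.
  by case: x => // _; exists [::]; rewrite ?packed_nil.
have [wa pwa <-] := opt _ Ha; have [wb pwb <-] := opt _ Hb.
have [ws pws <-] : exists2 ws, all packed ws & map rho ws = s.
  elim: s Hs => [|x s IH] /=; first by exists [::].
  by case=> /opt[w pw <-] /IH[ws pws <-]; exists (w :: ws) => //=; rewrite pw.
have [v [vs E]] : exists v vs, rcons ws wb = v :: vs.
  by case: (ws) => [|v vs]; [exists wb, [::] | exists v, (rcons vs wb)].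
have pks : all packed [:: wa, v & vs].
  by rewrite -E /= all_rcons pwa pwb.
exists (join_ones wa (v :: vs)); first exact: join_ones_packed.
rewrite rhoE; last by case: (wa).
rewrite split_join_ones // -map_comp.
have -> : [seq ((fun u => rho (Pack u)) \o map (addn 1)) w | w <- [:: wa, v & vs]]
    = map rho [:: wa, v & vs].
  apply/eq_in_map=> w /(allP pks) pw /=.
  by rewrite -[map _ w]/[seq 1 + a | a <- w] Pack_addn packed_id.
rewrite map_cons -[map rho (v :: vs)]/(map rho (v :: vs)) -E map_rcons.
case: (map rho ws) => [|x xs] //=; congr (Some (SNode _ _ _)).
  by rewrite belast_rcons.
by rewrite last_rcons.
Qed.

Lemma pword_rho_surj (t : stree1) : exists w : pword, rho w = Some t.
Proof.
have [w pw wt] := rho_surj (Some t).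
have wP : packed w && (w != [::]) by rewrite pw; apply: contra_eq_neq wt => ->.
by exists (PWord wP).
Qed.

Local Close Scope nat_scope.

(** * Coefficients of the coproducts, and their compatibility with [psi] *)

Lemma sum_indicator (R : nzSemiRingType) (I : eqType) (r : seq I)
    (P Q : pred I) (i0 : I) :
  uniq r -> {in r, forall i, P i -> Q i -> i = i0} ->
  \sum_(i <- r | P i) (Q i)%:R = [&& i0 \in r, P i0 & Q i0]%:R :> R.
Proof.
move=> r_uniq Q1; rewrite big_mkcond /=.
have [/and3P[i0r Pi0 Qi0]|i0P] := boolP [&& _, _ & _].
  rewrite (bigD1_seq i0) //= Pi0 Qi0 big1_seq ?addr0 // => i /andP[i_neq ir].
  case: ifP => // Pi; case: (boolP (Q i)) => // /(Q1 i ir Pi) iE.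
  by rewrite iE eqxx in i_neq.
rewrite big1_seq // => i /andP[_ ir]; case: ifP => // Pi.
case: (boolP (Q i)) => // Qi; have iE := Q1 i ir Pi Qi.
by rewrite -iE ir Pi Qi in i0P.
Qed.

(* The coefficients of the coproducts, b telling on which side of the cut the
   first letter falls: a word with a cut is a shuffle of its two parts. *)
Definition coproduct_by_shuffles (k : fieldType) (b : bool)
    (d : {linear QSh k -> tensor k pword pword}) : Prop :=
  forall (y : QSh k) (w1 w2 : pword), (d y)@_(w1, w2) =
    \sum_(m <- shuffle_masks (size w1) (size w2) | head false m == b)
      y@_(pshuffle m w1 w2).

Lemma sum_shuffles (k : fieldType) (b : bool) (w w1 w2 : pword) :
  \sum_(m <- shuffle_masks (size w1) (size w2) | head false m == b)
      (<< w >> : QSh k)@_(pshuffle m w1 w2)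
  = [&& (0 < maxw w1 < maxw w)%N, (head 0%N (val w) <= maxw w1)%N == b,
     restrict w (maxw w1) == w1 & pack_rest w (maxw w1) == w2]%:R.
Proof.
(* The only mask that can shuffle [w1] and [w2] into [w]; its first bit tells on which side of the
   cut the first letter falls. *)
pose m0 := [seq (a <= maxw w1)%N | a <- val w].
rewrite (eq_bigr (fun m => (pshuffle m w1 w2 == w)%:R)); last first.
  by move=> m _; rewrite mcoeffU eq_sym.
rewrite (sum_indicator _ (i0 := m0)) ?shuffle_masks_uniq //; last first.
  move=> m mP _ /eqP wE.
  have [E _ _] := shifted_shuffleP (pword_packed w2) mP.
  by rewrite /m0 -[in RHS]wE val_pshuffle // E.
have -> : head false m0 = (head 0%N (val w) <= maxw w1)%N.
  by rewrite /m0; case: (val w) (pword_neq0 w).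
by rewrite andbCA -cut_shuffle andbCA.
Qed.

(** At most one cut contributes, since [restrict w i] has maximum [i]. *)
Lemma sum_cuts (k : fieldType) (r : seq nat) (w w1 w2 : pword) :
  uniq r -> {in r, forall i, (0 < i < maxw w)%N} ->
  (\sum_(i <- r)
     (<< (restrict w i, pack_rest w i) >> : tensor k pword pword))@_(w1, w2)
  = [&& maxw w1 \in r, restrict w (maxw w1) == w1 & pack_rest w (maxw w1) == w2]%:R.
Proof.
move=> r_uniq rP; rewrite raddf_sum /=.
rewrite (eq_bigr (fun i => ((restrict w i == w1) && (pack_rest w i == w2))%:R)).
  rewrite (sum_indicator _ (i0 := maxw w1)) // => i /rP iP _ /andP[/eqP<- _].
  by rewrite maxw_restrict.
by move=> i _; rewrite mcoeffU.
Qed.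

Lemma pword_head_gt0 (w : pword) : (0 < head 0%N (val w))%N.
Proof.
case: w => -[|a w] /= wP; first by rewrite andbF in wP.
by apply: packed_gt0 (mem_head a w); case/andP: wP.
Qed.

Lemma pword_head_max (w : pword) : (head 0%N (val w) <= maxw w)%N.
Proof.
apply: (maxw_leq _ _ (leqnn _)); rewrite -[pword_val w]/(val w).
by case: (val w) (pword_neq0 w) => //= a v _; apply: mem_head.
Qed.

Lemma coproduct_by_shufflesP (k : fieldType) (b : bool)
    (d : {linear QSh k -> tensor k pword pword}) :
  (forall w w1 w2 : pword, (d << w >>)@_(w1, w2)
     = [&& (0 < maxw w1 < maxw w)%N, (head 0%N (val w) <= maxw w1)%N == b,
        restrict w (maxw w1) == w1 & pack_rest w (maxw w1) == w2]%:R) ->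
  coproduct_by_shuffles b d.
Proof.
move=> dU y w1 w2; elim/malg_ind: y => [|c x y IHx IHy|w].
- by rewrite linear0 mcoeff0 big1 // => m _; rewrite mcoeff0.
- rewrite linearP mcoeffD mcoeffZ IHx IHy mulr_sumr -big_split.
  by apply: eq_bigr => m _ /=; rewrite mcoeffD mcoeffZ.
- by rewrite dU sum_shuffles.
Qed.

Lemma qsh_dprec_shuffles (k : fieldType) : coproduct_by_shuffles true (qsh_dprec k).
Proof.
apply: coproduct_by_shufflesP => w w1 w2.
rewrite /qsh_dprec /= lin_extU sum_cuts ?iota_uniq //; last first.
  move=> i; rewrite mem_index_iota => /andP[le_i ->]; rewrite andbT.
  exact: leq_trans (pword_head_gt0 w) le_i.
rewrite mem_index_iota eqb_id pword_max_gt0 /= !andbA.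
by rewrite [((_ < _) && (_ <= _))%N]andbC.
Qed.

Lemma qsh_dsucc_shuffles (k : fieldType) : coproduct_by_shuffles false (qsh_dsucc k).
Proof.
apply: coproduct_by_shufflesP => w w1 w2.
rewrite /qsh_dsucc /= lin_extU sum_cuts ?iota_uniq //; last first.
  move=> i; rewrite mem_index_iota => /andP[-> lt_i] /=.
  exact: leq_trans lt_i (pword_head_max w).
rewrite mem_index_iota eqbF_neg -ltnNge pword_max_gt0 /= !andbA.
have -> : (maxw w1 < maxw w)%N && (maxw w1 < head 0%N (val w))%N
    = (maxw w1 < head 0%N (val w))%N.
  apply/andP/idP => [[]//|lt_h]; split=> //.
  exact: leq_trans lt_h (pword_head_max w).
by [].
Qed.

Lemma Omega_dual (k : fieldType) :
  lin_dual (Omega k) (fun w : pword => rho w).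
Proof. by apply: lin_dualP => t w; rewrite mcoeff_Omega. Qed.

(** On permutations [rho] takes binary values, so [binarize] loses nothing; other packed words do
    not occur in the image. *)
Lemma Omega_perm_dual (k : fieldType) : lin_dual (Omega_perm k)
  (fun w : pword => if permw w then binarize (rho w) else None).
Proof.
apply: lin_dualP => t w; rewrite mcoeff_Omega_perm -/(val w).
case: ifP => //= pw; congr (nat_of_bool _)%:R.
rewrite rho_uniq ?permw_uniq //; last exact: pword_packed.
rewrite schroederK; case: (binarize _) => //= u.
by rewrite !(inj_eq Some_inj) (can_eq schroeder1K).
Qed.

Lemma psi_coproduct (k : fieldType) (b : bool)
    (dQ : {linear QSh k -> tensor k pword pword})
    (dP : {linear PBT k -> tensor k ptree1 ptree1})
    (dS : {linear ST k -> tensor k stree1 stree1}) :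
  coproduct_by_shuffles b dQ ->
  commutes_with_coproducts (Omega_perm k) dP dQ ->
  commutes_with_coproducts (Omega k) dS dQ ->
  commutes_with_coproducts (psi k) dP dS.
Proof.
move=> dQE dPP dSP x.
apply: (tensmap_inj (@Omega_dual k)) => [t|]; first exact: pword_rho_surj.
apply/malgP=> -[w1 w2]; rewrite -dSP dQE.
have [s1 [s2 [[sz1 sz2 ps1 ps2 sP] [Es1 Es2]]]] := exists_permutation_pword w1 w2.
(* Both sides are compared with the coproduct of [Omega_perm k x] at the standardizations.
   Corresponding shuffles have the same binarized tree, so both read the same coefficient of [x]. *)
transitivity ((tensmap (Omega_perm k) (Omega_perm k) (dP x))@_(s1, s2)).
  rewrite -dPP dQE sz1 sz2 big_seq_cond [RHS]big_seq_cond.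
  apply: eq_bigr => m /andP[mP _]; rewrite Omega_dual Omega_perm_dual.
  have [-> ->] := sP m mP.
  by case: (rho _) => //= t; rewrite psi_dual.
rewrite (tensmap_dual (@Omega_perm_dual k) (@Omega_perm_dual k)) /= ps1 ps2 Es1 Es2.
rewrite (tensmap_dual (@Omega_dual k) (@Omega_dual k)) /=.
case: (rho w1) => //= t1; case: (rho w2) => //= t2.
by rewrite (tensmap_dual (@psi_dual k) (@psi_dual k)).
Qed.

Theorem theorem48 (k : fieldType)
    (* the coproducts of PBT and ST: the linear maps with which Omega_perm and
       Omega commute *)
    (pbt_dprec pbt_dsucc : {linear PBT k -> tensor k ptree1 ptree1})
    (st_dprec st_dsucc : {linear ST k -> tensor k stree1 stree1})
    (pbt_dprecP :
       commutes_with_coproducts (Omega_perm k) pbt_dprec (qsh_dprec k))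
    (pbt_dsuccP :
       commutes_with_coproducts (Omega_perm k) pbt_dsucc (qsh_dsucc k))
    (st_dprecP : commutes_with_coproducts (Omega k) st_dprec (qsh_dprec k))
    (st_dsuccP : commutes_with_coproducts (Omega k) st_dsucc (qsh_dsucc k)) :
  [/\ injective (psi k),
      forall s t : PBT k,
        psi k (pbt_prec s t) = st_preceq (psi k s) (psi k t),
      forall s t : PBT k,
        psi k (pbt_succ s t) = st_succ (psi k s) (psi k t),
      commutes_with_coproducts (psi k) pbt_dprec st_dprec &
      commutes_with_coproducts (psi k) pbt_dsucc st_dsucc].
Proof.
split.
- exact: psi_inj.
- exact: psi_prec.
- exact: psi_succ.
- exact: psi_coproduct (@qsh_dprec_shuffles k) pbt_dprecP st_dprecP.
- exact: psi_coproduct (@qsh_dsucc_shuffles k) pbt_dsuccP st_dsuccP.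
Qed.
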